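(* Let $Y=\begin{pmatrix}X\\ U\end{pmatrix}$ be a piecewise continuously differentiable Lagrangian path on $[a,b]$ and assume that $$[Y'(t)]^T\mathcal JY(t)=-Y^T(t)\mathcal JY'(t)\geq0,\qquad t\in[a,b].$$ Then the subspace $\operatorname{Im}X(t)$ is piecewise constant on $[a,b]$ and $$\mathcal N(Y,[a,b])=\sum_{t_0\in(a,b]}\big(\operatorname{rank}X(t_0^-)-\operatorname{rank}X(t_0)\big)\geq0,$$ $$\mathcal N^*(Y,[a,b])=\sum_{t_0\in[a,b)}\big(\operatorname{rank}X(t_0^+)-\operatorname{rank}X(t_0)\big)\geq0,$$ where the sums are finite (i.e. have only finitely many nonzero terms).
   Context: Notation. $n\in\mathbb N$, $[a,b]\subseteq\mathbb R$, $\mathcal J=\begin{pmatrix}0&I\\ -I&0\end{pmatrix}\in\mathbb R^{2n\times2n}$, $E=\begin{pmatrix}0\\ I\end{pmatrix}\in\mathbb R^{2n\times n}$. A real $2n\times 2n$ matrix $S$ is symplectic if $S^T\mathcal JS=\mathcal J$. A Lagrangian plane is a constant $Y\in\mathbb R^{2n\times n}$ with $Y^T\mathcal JY=0$ and $\operatorname{rank}Y=n$. A continuous Lagrangian path on $[a,b]$ is a continuous $Y:[a,b]\to\mathbb R^{2n\times n}$ such that every $Y(t)$ is a Lagrangian plane; it is piecewise continuously differentiable if it is continuous with piecewise continuous derivative (conditions on $Y'$ at the finitely many break points are understood for one-sided derivatives). We write $Y=\begin{pmatrix}X\\ U\end{pmatrix}$ with $n\times n$ blocks (similarly $\hat Y$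 with $\hat X,\hat U$). The Wronskian is $W(Y,\hat Y)=Y^T\mathcal J\hat Y$. For a symmetric matrix, $\geq0$ means positive semidefinite. $\operatorname{rank}X(t_0^-)$ and $\operatorname{rank}X(t_0^+)$ denote the left-hand and right-hand limits at $t_0$ of the function $t\mapsto\operatorname{rank}X(t)$. Comparative index. For Lagrangian planes $Y,\hat Y$ put $\mathcal M=(I-X^\dagger X)W(Y,\hat Y)$, $V=I-\mathcal M^\dagger\mathcal M$, $\mathcal P=V[W(Y,\hat Y)]^TX^\dagger\hat XV$ (a symmetric matrix), where $\dagger$ is the Moore–Penrose pseudoinverse. The comparative index and dual comparative index are $\mu(Y,\hat Y)=\operatorname{rank}\mathcal M+\operatorname{ind}\mathcal P$, $\mu^*(Y,\hat Y)=\operatorname{rank}\mathcal M+\operatorname{ind}(-\mathcal P)$, with $\operatorname{ind}$ the number of negative eigenvalues. Oscillation numbers. For a continuous Lagrangian path $Y$ on $[a,b]$ take a partition $a=t_0<t_1<\dots<t_p=b$ and real symplectic matrix functions $R_k(t)$, $k=0,\dots,p-1$, with $R_k$ continuous on $[t_k,t_{k+1}]$ and such that, for each $k$, both $\operatorname{rank}W(R_k(t)E,Y(t))$ and $\operatorname{rank}\big((I\ \,0)R_k(t)E\big)$ are constant for $t\in[t_k,t_{k+1}]$. Then $$\mathcal N(Y,[a,b]):=\sum_{k=0}^{p-1}\big[\mu(Y(t_{k+1}),R_k(t_{k+1})E)-\mu(Y(t_k),R_k(t_k)E)\big],$$ $$\mathcal N^*(Y,[a,b]):=\sum_{k=0}^{p-1}\big[\mu^*(Y(t_k),R_k(t_k)E)-\mu^*(Y(t_{k+1}),R_k(t_{k+1})E)\big].$$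 Such partitions and systems exist and the values do not depend on their choice. *)

(* Defs.v *)
From HB Require Import structures.
From mathcomp Require Import all_boot all_order all_algebra.
From mathcomp Require Import all_classical all_reals all_analysis.

Set Implicit Arguments.
Unset Strict Implicit.
Unset Printing Implicit Defensive.

Import Order.TTheory GRing.Theory Num.Theory.
Import numFieldNormedType.Exports.

Local Open Scope classical_set_scope.
Local Open Scope ring_scope.

Section LinearAlgebra.
Variable R : realType.

Definition psdmx n (A : 'M[R]_n) : Prop :=
  A^T = A /\ forall x : 'cV[R]_n, 0 <= (x^T *m A *m x) 0 0.

Definition im_mx m n (A : 'M[R]_(m, n)) : set 'cV[R]_m :=
  range (fun v : 'cV[R]_n => A *m v).

Definition is_moore_penrose m n (A : 'M[R]_(m, n)) (B : 'M[R]_(n, m)) : Prop :=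
  [/\ A *m B *m A = A, B *m A *m B = B,
      (A *m B)^T = A *m B & (B *m A)^T = B *m A].

(* Not MathComp's [pinvmx], which is only some partial inverse. *)
Definition mpinvmx m n (A : 'M[R]_(m, n)) : 'M[R]_(n, m) :=
  xget 0 [set B | is_moore_penrose A B].

Lemma is_moore_penrose_unique m n (A : 'M[R]_(m, n)) (B C : 'M[R]_(n, m)) :
  is_moore_penrose A B -> is_moore_penrose A C -> B = C.
Proof.
move=> [ABA BAB ABt BAt] [ACA CAC ACt CAt].
have eAB : A *m B = A *m C.
  by rewrite -[in LHS]ACA -mulmxA -ACt -[A *m B]ABt -trmx_mul mulmxA ABA ACt.
have eBA : B *m A = C *m A.
  rewrite -[in LHS]ACA -mulmxA mulmxA -[C *m A]CAt -[B *m A]BAt.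
  by rewrite -trmx_mul -mulmxA [A *m _]mulmxA ABA CAt.
by rewrite -BAB -mulmxA eAB mulmxA eBA CAC.
Qed.

Lemma gram_unitmx m r (C : 'M[R]_(m, r)) :
  \rank C = r -> C^T *m C \in unitmx.
Proof.
move=> rC; rewrite -row_free_unit; apply/inj_row_free => v vCC0.
have vC0 : v *m C^T = 0.
  have s0 : \sum_j (v *m C^T) 0 j ^+ 2 = 0.
    transitivity ((v *m (C^T *m C) *m v^T) 0 0); last by rewrite vCC0 mul0mx mxE.
    have -> : v *m (C^T *m C) *m v^T = (v *m C^T) *m (v *m C^T)^T.
      by rewrite trmx_mul trmxK !mulmxA.
    by rewrite [RHS]mxE; apply: eq_bigr => j _; rewrite [_^T _ _]mxE expr2.
  apply/rowP => j; rewrite [RHS]mxE; apply/eqP; rewrite -sqrf_eq0; apply/eqP.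
  by apply: (psumr_eq0P _ s0) => // i _; exact: sqr_ge0.
have fC : row_free C^T by rewrite /row_free mxrank_tr rC.
by apply: (row_free_inj fC); rewrite vC0 mul0mx.
Qed.

Lemma mpinvmxP m n (A : 'M[R]_(m, n)) : is_moore_penrose A (mpinvmx A).
Proof.
suff [B AB] : exists B, is_moore_penrose A B.
  by rewrite /mpinvmx; case: xgetP => // /(_ B).
have [r [C [D [eA rC rD]]]] : exists r (C : 'M[R]_(m, r)) (D : 'M[R]_(r, n)),
    [/\ A = C *m D, \rank C = r & \rank D = r].
  exists (\rank A), (col_base A), (row_base A); rewrite mulmx_base; split=> //.
    exact/eqP/col_base_full.
  exact/eqP/row_base_free.
have uC : C^T *m C \in unitmx by exact: gram_unitmx.
have uD : D *m D^T \in unitmx.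
  by rewrite -[D in D *m _]trmxK; apply: gram_unitmx; rewrite mxrank_tr.
pose K := invmx (C^T *m C); pose L := invmx (D *m D^T).
have KC : K *m C^T *m C = 1%:M by rewrite -mulmxA mulVmx.
have DL : D *m (D^T *m L) = 1%:M by rewrite mulmxA mulmxV.
have Kt : K^T = K by rewrite trmx_inv trmx_mul trmxK.
have Lt : L^T = L by rewrite trmx_inv trmx_mul trmxK.
pose B := (D^T *m L) *m (K *m C^T).
have AB : A *m B = C *m (K *m C^T).
  by rewrite eA /B mulmxA -[C *m D *m _]mulmxA DL mulmx1.
have BA : B *m A = D^T *m L *m D.
  by rewrite eA /B mulmxA -[_ *m C]mulmxA KC mulmx1.
exists B; split; rewrite ?AB ?BA.
- by rewrite eA mulmxA -[C *m _ *m C]mulmxA KC mulmx1.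
- by rewrite /B mulmxA -[_ *m D *m _]mulmxA DL mulmx1.
- by rewrite !trmx_mul trmxK Kt mulmxA.
- by rewrite !trmx_mul trmxK Lt mulmxA.
Qed.

(* [mup x p] is the multiplicity of x as a root of p. *)
Definition ind n (A : 'M[R]_n) : nat :=
  \sum_(x \in [set x : R | eigenvalue A x /\ x < 0]) mup x (char_poly A).

End LinearAlgebra.

Section Symplectic.
Variables (R : realType) (n : nat).
Implicit Types Y Yh : 'M[R]_(n + n, n).

Definition Jmx : 'M[R]_(n + n) := block_mx 0 1%:M (- 1%:M) 0.
Definition Emx : 'M[R]_(n + n, n) := col_mx 0 1%:M.

Definition symplectic (S : 'M[R]_(n + n)) : Prop := S^T *m Jmx *m S = Jmx.

Definition lagrangian Y : Prop := Y^T *m Jmx *m Y = 0 /\ \rank Y = n.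

Definition wronskian Y Yh : 'M[R]_n := Y^T *m Jmx *m Yh.

(* The blocks X and U of Y are [usubmx Y] and [dsubmx Y]. *)
Definition cindM Y Yh : 'M[R]_n :=
  (1%:M - mpinvmx (usubmx Y) *m usubmx Y) *m wronskian Y Yh.

Definition cindV Y Yh : 'M[R]_n :=
  1%:M - mpinvmx (cindM Y Yh) *m cindM Y Yh.

Definition cindP Y Yh : 'M[R]_n :=
  cindV Y Yh *m (wronskian Y Yh)^T *m mpinvmx (usubmx Y) *m usubmx Yh
    *m cindV Y Yh.

Definition cind Y Yh : nat := (\rank (cindM Y Yh) + ind (cindP Y Yh))%N.

Definition dual_cind Y Yh : nat :=
  (\rank (cindM Y Yh) + ind (- cindP Y Yh))%N.

End Symplectic.

Section Paths.
Variables (R : realType) (n : nat).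
Implicit Types (Y : R -> 'M[R]_(n + n, n)) (a b t : R) (s : seq R).

(* A path on [a, b] is a total function of which only the values on [a, b]
   matter, and [itv_partition a b s] says that t_0 = a < t_1 < ... < t_p = b,
   where t_1, ..., t_p are the elements of s; [knot a b s k] is t_k. *)
Definition knot a b s (k : nat) : R := nth b (a :: s) k.

Definition lagrangian_path Y a b : Prop :=
  {within `[a, b], continuous Y} /\ {in `[a, b], forall t, lagrangian (Y t)}.

Definition piecewise_C1 Y a b : Prop :=
  {within `[a, b], continuous Y} /\
  exists2 s, itv_partition a b s &
    forall k, (k < size s)%N ->
      let u := knot a b s k in let v := knot a b s k.+1 in
      [/\ {in `]u, v[, forall t, derivable Y t 1},
          {in `]u, v[, continuous (derive1 Y)},
          cvg (derive1 Y t @[t --> u^'+]) &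
          cvg (derive1 Y t @[t --> v^'-])].

Definition right_derivative Y t : 'M[R]_(n + n, n) :=
  lim (h^-1 *: (Y (t + h) - Y t) @[h --> 0^'+]).

Definition left_derivative Y t : 'M[R]_(n + n, n) :=
  lim (h^-1 *: (Y (t + h) - Y t) @[h --> 0^'-]).

(* Away from the break points and from a and b both one-sided derivatives are
   Y'(t). The symmetry required by [psdmx] is the identity
   Y'^T J Y = - Y^T J Y'. *)
Definition monotone_path Y a b : Prop :=
  {in `[a, b[, forall t, psdmx ((right_derivative Y t)^T *m Jmx R n *m Y t)} /\
  {in `]a, b], forall t, psdmx ((left_derivative Y t)^T *m Jmx R n *m Y t)}.

Definition piecewise_constant_on T (f : R -> T) a b : Prop :=
  exists2 s, itv_partition a b s &
    forall k, (k < size s)%N ->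
      {in `]knot a b s k, knot a b s k.+1[ &, forall t u, f t = f u}.

Definition rank_left Y t : nat := lim (\rank (usubmx (Y u)) @[u --> t^'-]).
Definition rank_right Y t : nat := lim (\rank (usubmx (Y u)) @[u --> t^'+]).

Definition osc_system Y a b s (S : nat -> R -> 'M[R]_(n + n)) : Prop :=
  itv_partition a b s /\
  forall k, (k < size s)%N ->
    let I := `[knot a b s k, knot a b s k.+1] in
    [/\ {in I, forall t, symplectic (S k t)},
        {within [set` I], continuous (S k)},
        {in I &, forall t u, \rank (wronskian (S k t *m Emx R n) (Y t)) =
                             \rank (wronskian (S k u *m Emx R n) (Y u))} &
        {in I &, forall t u, \rank (row_mx 1%:M 0 *m S k t *m Emx R n) =
                             \rank (row_mx 1%:M 0 *m S k u *m Emx R n)}].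

Definition osc_sum Y a b s (S : nat -> R -> 'M[R]_(n + n)) : int :=
  \sum_(k < size s)
    ((cind (Y (knot a b s k.+1)) (S k (knot a b s k.+1) *m Emx R n))%:Z -
     (cind (Y (knot a b s k)) (S k (knot a b s k) *m Emx R n))%:Z).

Definition dual_osc_sum Y a b s (S : nat -> R -> 'M[R]_(n + n)) : int :=
  \sum_(k < size s)
    ((dual_cind (Y (knot a b s k)) (S k (knot a b s k) *m Emx R n))%:Z -
     (dual_cind (Y (knot a b s k.+1)) (S k (knot a b s k.+1) *m Emx R n))%:Z).

(* For a continuous Lagrangian path systems exist and the sums do not depend on
   the system, so neither the default value nor the choice made by [xget]
   matters. *)
Definition osc_number Y a b : int :=
  xget 0 [set N | exists s S, osc_system Y a b s S /\ N = osc_sum Y a b s S].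

Definition dual_osc_number Y a b : int :=
  xget 0 [set N | exists s S,
                    osc_system Y a b s S /\ N = dual_osc_sum Y a b s S].

End Paths.

(* Main.v *)
(* A plane near Y(t0) transversal to the image of (I; q I) is, in the coordinates
   (X, U - q X), the graph of the symmetric matrix A = X (U - q X)^-1, which has
   the image and the rank of X. Monotonicity of Y says exactly that A(t) is
   nondecreasing in the Loewner order, so its negative and positive indices are
   monotone integer-valued functions: they have finitely many jumps, between
   which the kernel of A, hence Im X, is constant. By lower semicontinuity of the
   indices, rank X drops at t0 from the left by the loss of negative index and
   from the right by the gain of positive index.
   If Z is the graph of B in the same coordinates, then
     mu(Y, Z) = ind B + ind(A - B) - ind A,
   because both mu(Y, Z) + ind A and ind B + ind(A - B) are the negative index of
   the block matrix [[B, B], [B, A]]; mu^* is obtained by changing the signs of A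
   and B. Along an admissible system B and A - B have constant rank, hence
   constant index, so only the jumps of ind A contribute. *)
Require Import Defs.
From HB Require Import structures.
From mathcomp Require Import all_boot all_order all_algebra.
From mathcomp Require Import all_classical all_reals all_analysis.
From mathcomp Require Import complex ring lra zify.

Set Implicit Arguments.
Unset Strict Implicit.
Unset Printing Implicit Defensive.

Import Order.TTheory GRing.Theory Num.Theory.
Import numFieldNormedType.Exports.

Local Open Scope classical_set_scope.
Local Open Scope ring_scope.

(** * Symmetric matrices and their negative index *)

Section SymmetricMatrices.
Variable R : realType.

(** The index is defined by roots of the characteristic polynomial. A real spectral theorem converts
    it into two certificates, a frame of [ind A] rows on which the form is negative and a space cut
    out by [ind A] equations on which it is nonnegative; later estimates on indices play one against
    the other. Two obstacles shape the rest. A single [q] may fail somewhere along the path, so a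
    chart is used only near one point, and its chart-free consequences (images, ranks, comparative
    indices) are propagated by an induction over the real interval. Moreover the image may really
    change at isolated points, so local statements concern one side of a point and come in a left
    and a right version; on matrices, reversing both time and sign exchanges the two. *)

Lemma sym_eigenvalue n (A : 'M[R]_n.+1) : A^T = A -> exists r, eigenvalue A r.
Proof.
move=> At; pose AC := map_mx (real_complex R) A.
have hA : AC \is hermsymmx.
  apply: realsym_hermsym.
    by apply/is_hermitianmxP; rewrite expr0 scale1r map_mx_id // map_trmx At.
  apply/mxOverP => i j; rewrite mxE; apply/complex_realP.
  by exists (A i j).
have /orthomx_spectralP eA := hermitian_normalmx hA.
set d := spectral_diag AC in eA; set S := spectralmx AC in eA.
have uS : S \in unitmx := spectral_unit AC.
have ev : eigenvalue AC (d 0 0).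
  apply/eigenvalueP; exists (row 0 S); last first.
    apply/negP => /eqP r0; have := row_free_unit S; rewrite uS => /row_freeP [B SB].
    have := congr1 (fun M => row 0 M 0 0) SB; rewrite row_mul r0 mul0mx !mxE eqxx.
    by move/eqP; rewrite eq_sym oner_eq0.
  rewrite -row_mul eA !mulmxA mulmxV // mul1mx row_mul row_diag_mx.
  by rewrite -scalemxAl -rowE.
have /mxOverP/(_ 0 0) := hermitian_spectral_diag_real hA; rewrite -/d =>
  /complex_realP [r dr].
by exists r; move: ev; rewrite !eigenvalue_root_char dr /AC -map_char_poly fmorph_root.

Qed.

Lemma row_norm_gt0 n (v : 'rV[R]_n) : v != 0 -> 0 < (v *m v^T) 0 0.
Proof.
move=> v0; have e : (v *m v^T) 0 0 = \sum_j v 0 j ^+ 2.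
  by rewrite mxE; apply: eq_bigr => j _; rewrite mxE expr2.
have s0 : 0 <= \sum_j v 0 j ^+ 2 by apply: sumr_ge0 => j _; exact: sqr_ge0.
rewrite e lt0r s0 andbT; apply: contra v0 => /eqP z.
apply/eqP/rowP => j; rewrite [RHS]mxE; apply/eqP; rewrite -sqrf_eq0; apply/eqP.
by apply: (psumr_eq0P _ z) => // i _; exact: sqr_ge0.
Qed.

(* The Householder reflection exchanging [v] and the first basis vector. *)
Lemma orthogonal_first_row n (v : 'rV[R]_n.+1) : v *m v^T = 1%:M ->
  exists2 H : 'M[R]_n.+1, H *m H^T = 1%:M & row 0 H = v.
Proof.
move=> v1; pose e : 'rV[R]_n.+1 := delta_mx 0 0.
have [->|ve] := eqVneq v e.
  by exists 1%:M; rewrite ?trmx1 ?mulmx1 // row1.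
pose w := v - e; pose c := 2 / (w *m w^T) 0 0.
have w0 : 0 < (w *m w^T) 0 0 by apply: row_norm_gt0; rewrite subr_eq0.
have cw : c *: (w *m w^T) = 2%:M.
  by rewrite [w *m w^T]mx11_scalar scale_scalar_mx mulfVK // gt_eqF.
pose K := w^T *m (c *: w); pose H := 1%:M - K.
have Kt : K^T = K by rewrite /K trmx_mul trmxK linearZ /= -scalemxAl scalemxAr.
have KK : K *m K = K *+ 2.
  rewrite {1}/K -mulmxA [_ *m K]mulmxA -scalemxAl cw mul_scalar_mx -scalemxAr.
  by rewrite scaler_nat.
have HH : H *m H^T = 1%:M.
  rewrite linearB /= Kt trmx1 mulmxBr mulmx1 mulmxBl mul1mx KK mulr2n.
  by rewrite opprB addrK subrK.
exists H => //; rewrite rowE mulmxBr mulmx1 mulmxA -/e.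
have tr11 (M : 'M[R]_1) : M^T = M by apply/matrixP => i j; rewrite mxE !ord1.
(* Both [v] and [e] are unit vectors, so v.w = - e.w and w.w = - 2 e.w; the reflection therefore
   moves [e] by exactly [w]. *)
have vv : v *m w^T = - (e *m w^T).
  rewrite /w linearB /= !mulmxBr v1 opprB; congr (_ - _).
    by rewrite trmx_delta mul_delta_mx; apply/matrixP => i j; rewrite !ord1 !mxE eqxx.
  by rewrite -[LHS]tr11 trmx_mul trmxK.
have e1 : c *: (e *m w^T) = - 1%:M.
  have : c *: (w *m w^T) = - 2 *: (c *: (e *m w^T)).
    by rewrite {1}/w mulmxBl vv -opprD scalerN scaleNr -mulr2n -scaler_nat scalerA
      mulrC -scalerA.
  rewrite cw => /(congr1 (fun M => (- 2)^-1 *: M)); rewrite scalerA mulVf ?oppr_eq0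
    ?pnatr_eq0 // scale1r => <-.
  by rewrite scale_scalar_mx invrN mulNr mulVf ?pnatr_eq0 // raddfN.
by rewrite -scalemxAr scalemxAl e1 mulNmx mul1mx opprK addrC /w subrK.
Qed.

(** Deflation: rotating a unit eigenvector onto the first axis clears the first row, symmetry clears
    the first column, and the remaining block is symmetric of smaller size. *)
Lemma real_spectral_theorem n (A : 'M[R]_n) : A^T = A ->
  exists (P : 'M[R]_n) (d : 'rV[R]_n),
    P *m P^T = 1%:M /\ A = P^T *m diag_mx d *m P.
Proof.
elim: n => [|n IH] in A * => [|At].
  by exists 1%:M, 0; split; apply/matrixP => -[].
have [r /eigenvalueP [u uA u0]] := sym_eigenvalue At.
pose q := (Num.sqrt ((u *m u^T) 0 0))^-1; pose v := q *: u.
have uu := row_norm_gt0 u0.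
have v1 : v *m v^T = 1%:M.
  rewrite linearZ /= -scalemxAl -scalemxAr scalerA [_ *m _]mx11_scalar.
  rewrite scale_scalar_mx -expr2 exprVn sqr_sqrtr ?ltW // mulVf //.
  by rewrite gt_eqF.
have [H HH rH] := orthogonal_first_row v1.
have vA : v *m A = r *: v by rewrite -scalemxAl uA !scalerA mulrC.
pose B : 'M[R]_(1 + n) := H *m A *m H^T.
have Bt : B^T = B by rewrite /B !trmx_mul trmxK At mulmxA.
have B0 : row 0 B = r *: delta_mx 0 0.
  rewrite /B !row_mul rH vA -scalemxAl; congr (_ *: _).
  by rewrite -rH -row_mul HH row1.
have Bur : ursubmx B = 0.
  apply/matrixP => i j; rewrite !mxE.
  have := congr1 (fun M : 'rV[R]_(1 + n) => M 0 (rshift 1 j)) B0.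
  by rewrite !mxE ord1 (_ : lshift n 0 = 0) ?mulr0 // ; apply: val_inj.
have Bul : ulsubmx B = r%:M.
  apply/matrixP => i j; rewrite !ord1 !mxE.
  have := congr1 (fun M : 'rV[R]_(1 + n) => M 0 0) B0.
  by rewrite !mxE mulr1 (_ : lshift n 0 = 0) //; apply: val_inj.
have Bdl : dlsubmx B = 0.
  by rewrite -Bt -trmx_ursub Bur trmx0.
have Bdr : (drsubmx B)^T = drsubmx B by rewrite trmx_drsub Bt.
have [P [d [PP eB]]] := IH _ Bdr.
have HtH : H^T *m H = 1%:M by apply: mulmx1C.
pose Q : 'M[R]_(1 + n) := block_mx 1%:M 0 0 P.
pose D : 'M[R]_(1 + n) := diag_mx (row_mx r%:M d).
have QQ : Q *m Q^T = 1%:M.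
  rewrite /Q tr_block_mx mulmx_block.
  by rewrite !(trmx1, trmx0, mulmx0, mul0mx, mulmx1, addr0, add0r) PP -scalar_mx_block.
have QDQ : Q^T *m D *m Q = B.
  rewrite /D /Q diag_mx_row tr_block_mx !mulmx_block.
  rewrite !(trmx1, trmx0, mulmx0, mul0mx, mulmx1, mul1mx, addr0, add0r) -eB.
  have -> : diag_mx (r%:M : 'rV[R]_1) = r%:M.
    by apply/matrixP => i j; rewrite !ord1 !mxE eqxx.
  by rewrite -Bul -[X in block_mx _ X]Bur -[X in block_mx _ _ X]Bdl submxK.
exists (Q *m H), (row_mx r%:M d); split.
  by rewrite trmx_mul mulmxA -[_ *m H *m H^T]mulmxA HH mulmx1.
rewrite trmx_mul !mulmxA -[H^T *m _ *m _]mulmxA -[H^T *m _ *m Q]mulmxA -/D QDQ.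
by rewrite !mulmxA HtH mul1mx -mulmxA HtH mulmx1.
Qed.

Lemma char_poly_orthogonal_diag n (P : 'M[R]_n) (d : 'rV[R]_n) :
  P *m P^T = 1%:M ->
  char_poly (P^T *m diag_mx d *m P) = \prod_(i < n) ('X - (d 0 i)%:P).
Proof.
move=> PP; have PtP : P^T *m P = 1%:M by apply: mulmx1C.
transitivity (char_poly (diag_mx d)); last first.
  rewrite char_poly_trig ?diag_mx_is_trig //.
  by apply: eq_bigr => i _; rewrite mxE eqxx.
have -> : char_poly (P^T *m diag_mx d *m P) =
    \det (map_mx polyC P^T *m char_poly_mx (diag_mx d) *m map_mx polyC P).
  rewrite /char_poly /char_poly_mx mulmxBr mulmxBl -!map_mxM /=.
  by rewrite scalar_mxC -[_%:M *m _ *m _]mulmxA -map_mxM /= PtP map_mx1 mulmx1.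
rewrite !det_mulmx mulrAC -det_mulmx -map_mxM /= PtP map_mx1 det1 mul1r.
by [].
Qed.

(** The bridge from root multiplicities to inertia arguments: the characteristic polynomial splits
    with the diagonal entries as roots. *)
Lemma ind_orthogonal_diag n (P : 'M[R]_n) (d : 'rV[R]_n) :
  P *m P^T = 1%:M ->
  ind (P^T *m diag_mx d *m P) = #|[set i | d 0 i < 0]%SET|.
Proof.
move=> PP; rewrite /ind; set A := _ *m P.
pose s := [seq d 0 i | i <- enum 'I_n].
have eA : char_poly A = \prod_(y <- s) ('X - y%:P).
  by rewrite char_poly_orthogonal_diag // big_map big_enum.
pose r := [seq x <- s | x < 0].
have rE x : (x \in r) = (x \in s) && (x < 0) by rewrite mem_filter andbC.
(* The sum over negative eigenvalues becomes a sum over the distinct negative entries;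
   multiplicities then restore the repetitions. *)
rewrite (fsbig_fwiden (undup r)) ?undup_uniq //=; last 2 first.
- move=> x [ex x0] /=; rewrite mem_undup rE x0 andbT.
  by move: ex; rewrite eigenvalue_root_char eA root_prod_XsubC.
- move=> x [/=]; rewrite mem_undup rE => /andP[xs x0] []; split=> //.
  by rewrite eigenvalue_root_char eA root_prod_XsubC.
have -> : (\sum_(x <- undup r) mup x (char_poly A) = \sum_(x <- r) 1)%N.
  rewrite -[RHS]big_undup_iterop_count big_seq [RHS]big_seq; apply: eq_bigr => x.
  rewrite mem_undup rE => /andP[xs x0].
  rewrite eA mu_prod_XsubC Monoid.iteropE iter_addn_0 mul1n.
  by rewrite /r count_filter; apply: eq_count => y /=; case: eqVneq => //= ->;
    rewrite x0.
rewrite sum1_size size_filter count_map -sum1_count big_enum_cond /= sum1dep_card.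
by rewrite cardsE.
Qed.

(** Row vectors turn the congruence [B *m A *m B^T] into the substitution [x *m B]. *)
Definition qform n (A : 'M[R]_n) (x : 'rV[R]_n) : R := (x *m A *m x^T) 0 0.

Lemma qform_diag n (d x : 'rV[R]_n) :
  qform (diag_mx d) x = \sum_i d 0 i * x 0 i ^+ 2.
Proof.
rewrite /qform mxE; apply: eq_bigr => i _; rewrite mul_mx_diag !mxE.
by rewrite mulrAC -expr2 mulrC.
Qed.

Lemma qformM m n (A : 'M[R]_n) (B : 'M[R]_(m, n)) x :
  qform (B *m A *m B^T) x = qform A (x *m B).
Proof. by rewrite /qform trmx_mul !mulmxA. Qed.

(** [E] keeps the coordinates in [S]; it isolates the part of a diagonalized matrix that belongs to
    chosen eigenvalues. *)
Lemma coordinate_selection n (S : {set 'I_n}) :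
  exists2 E : 'M[R]_(#|S|, n), E *m E^T = 1%:M &
    E^T *m E = diag_mx (\row_i (i \in S)%:R).
Proof.
exists (\matrix_(j, i) (i == enum_val j)%:R).
  apply/matrixP => j k; rewrite !mxE (bigD1 (enum_val j)) //= big1 => [|i ij].
    by rewrite !mxE eqxx mul1r addr0 (inj_eq enum_val_inj).
  by rewrite !mxE (negbTE ij) mul0r.
apply/matrixP => i k; rewrite !mxE.
have [iS|iS] := boolP (i \in S).
  rewrite (bigD1 (enum_rank_in iS i)) //= big1 => [|j ji]; rewrite !mxE.
    by rewrite enum_rankK_in // eqxx mul1r addr0 eq_sym.
  rewrite (_ : (i == _) = false) ?mul0r //; apply: contraNF ji => /eqP ij.
  by apply/eqP/enum_val_inj; rewrite enum_rankK_in.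
rewrite mul0rn big1 // => j _; rewrite !mxE (_ : (i == _) = false) ?mul0r //.
by apply: contraNF iS => /eqP ->; exact: enum_valP.
Qed.

Lemma rank_diag_mx n (d : 'rV[R]_n) :
  \rank (diag_mx d) = #|[set i | d 0 i != 0]%SET|.
Proof.
have [E EE EtE] := coordinate_selection [set i | d 0 i != 0]%SET.
apply/eqP; rewrite eqn_leq; apply/andP; split.
  have -> : diag_mx d = E^T *m (E *m diag_mx d).
    rewrite mulmxA EtE mulmx_diag; congr diag_mx; apply/rowP => i.
    by rewrite !mxE inE; case: eqVneq => [->|]; rewrite ?mulr0 ?mul1r.
  by apply: leq_trans (mxrankM_maxl _ _) _; rewrite rank_leq_col.
suff e : E *m diag_mx d *m (diag_mx (\row_i (d 0 i)^-1) *m E^T) = 1%:M.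
  rewrite -[X in (X <= _)%N](mxrank1 R) -e.
  by apply: leq_trans (mxrankM_maxl _ _) (mxrankM_maxr _ _).
have sel (X : 'M[R]_n) : E *m X *m E^T = E *m (E^T *m E *m X) *m E^T.
  by rewrite !mulmxA EE mul1mx.
rewrite mulmxA -[E *m _ *m _]mulmxA mulmx_diag sel.
set e := (X in diag_mx X); have -> : E^T *m E *m diag_mx e = E^T *m E.
  rewrite EtE mulmx_diag; congr diag_mx; apply/rowP => i; rewrite !mxE inE.
  by case: eqVneq => [->|d0]; rewrite ?mul0r // mul1r mulfV.
by rewrite mulmxA EE mul1mx EE.
Qed.

(** Eigenvectors of the negative eigenvalues, rescaled. Normalizing the form to minus the identity
    gives a definite margin under perturbation, which semicontinuity uses. *)
Lemma ind_negative_rows n (A : 'M[R]_n) : A^T = A ->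
  exists B : 'M[R]_(ind A, n), B *m A *m B^T = - 1%:M.
Proof.
move=> /real_spectral_theorem [P [d [PP ->]]]; rewrite ind_orthogonal_diag //.
have [E EE EtE] := coordinate_selection [set i | d 0 i < 0]%SET.
(* Where [d] is nonnegative the square root, hence its inverse, is 0; [E] discards these
   coordinates. *)
pose c := diag_mx (\row_i (Num.sqrt (- d 0 i))^-1).
exists (E *m c *m P).
have -> : E *m c *m P *m (P^T *m diag_mx d *m P) *m (E *m c *m P)^T =
    E *m (c *m diag_mx d *m c) *m E^T.
  rewrite !trmx_mul tr_diag_mx -/c !mulmxA -[_ *m P *m P^T]mulmxA PP mulmx1.
  by rewrite -[_ *m P *m P^T]mulmxA PP mulmx1.
have sel (X : 'M[R]_n) : E *m X *m E^T = E *m (E^T *m E *m X) *m E^T.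
  by rewrite !mulmxA EE mul1mx.
have -> : E *m (c *m diag_mx d *m c) *m E^T = - (E *m (E^T *m E) *m E^T).
  rewrite sel EtE -mulNmx -mulmxN -raddfN /=.
  rewrite !mulmx_diag; congr (_ *m diag_mx _ *m _).
  apply/rowP => i; rewrite !mxE inE.
  have [d0|_] := ltrP (d 0 i) 0; last by rewrite !mul0r oppr0.
  rewrite mul1r mulrAC -expr2 exprVn sqr_sqrtr ?oppr_ge0 ?ltW //.
  by rewrite invrN mulNr mulVf // lt_eqF.
by rewrite mulmxA EE mul1mx EE.
Qed.

(** The dual certificate: [C] reads off the coordinates along the negative eigenvectors, and the
    form is nonnegative where they all vanish. *)
Lemma ind_nonneg_kernel n (A : 'M[R]_n) : A^T = A ->
  exists C : 'M[R]_(n, ind A), forall x, x *m C = 0 -> 0 <= qform A x.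
Proof.
move=> /real_spectral_theorem [P [d [PP ->]]]; rewrite ind_orthogonal_diag //.
have [E EE EtE] := coordinate_selection [set i | d 0 i < 0]%SET.
exists (P^T *m E^T) => x xC.
rewrite -[P in _ *m P]trmxK qformM qform_diag; apply: sumr_ge0 => i _.
have [d0|d0] := ltrP (d 0 i) 0; last by rewrite mulr_ge0 ?sqr_ge0.
suff -> : (x *m P^T) 0 i = 0 by rewrite expr0n mulr0.
have := congr1 (fun M => (M *m E) 0 i) xC.
by rewrite /= mul0mx mulmxA -[_ *m E^T *m E]mulmxA EtE mul_mx_diag !mxE inE d0 mulr1.
Qed.

(** Sylvester's dimension count: if m < k, some nonzero [y] satisfies [y *m B *m C = 0], and the
    form would be both negative and nonnegative there. *)
Lemma ind_inertia_bound n k m (A : 'M[R]_n) (B : 'M[R]_(k, n))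
    (C : 'M[R]_(n, m)) :
  (forall y, y != 0 -> qform A (y *m B) < 0) ->
  (forall x, x *m C = 0 -> 0 <= qform A x) -> (k <= m)%N.
Proof.
move=> neg pos; rewrite leqNgt; apply/negP => mk.
have [y yBC y0] : exists2 y : 'rV[R]_k, y *m (B *m C) = 0 & y != 0.
  have : ~~ row_free (B *m C).
    by rewrite -row_leq_rank -ltnNge; apply: leq_ltn_trans (rank_leq_col _) mk.
  by rewrite -kermx_eq0 => /rowV0Pn [y /sub_kermxP yK y0]; exists y.
by have := neg _ y0; rewrite ltNge pos // -mulmxA.
Qed.

Lemma ind_le n k (A : 'M[R]_n) (C : 'M[R]_(n, k)) : A^T = A ->
  (forall x, x *m C = 0 -> 0 <= qform A x) -> (ind A <= k)%N.
Proof.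
move=> /ind_negative_rows [B eB] pos.
apply: (@ind_inertia_bound _ _ _ A B C) => // y y0.
by rewrite -qformM eB /qform mulmxN mulmx1 mulNmx mxE oppr_lt0 row_norm_gt0.
Qed.

Lemma ind_ge n k (A : 'M[R]_n) (B : 'M[R]_(k, n)) : A^T = A ->
  (forall y, y != 0 -> qform A (y *m B) < 0) -> (k <= ind A)%N.
Proof.
move=> /ind_nonneg_kernel [C pos] neg; exact: ind_inertia_bound neg pos.
Qed.

Lemma ind_addN n (A : 'M[R]_n) : A^T = A -> (ind A + ind (- A) = \rank A)%N.
Proof.
move=> /real_spectral_theorem [P [d [PP ->]]].
have -> : - (P^T *m diag_mx d *m P) = P^T *m diag_mx (- d) *m P.
  by rewrite raddfN /= mulmxN mulNmx.
have uP : P \in unitmx by have [] := mulmx1_unit PP.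
rewrite !ind_orthogonal_diag // mxrankMfree ?row_free_unit //.
rewrite eqmxMfull ?row_full_unit ?unitmx_tr // rank_diag_mx.
rewrite -cardsUI (_ : _ :&: _ = finset.set0) ?cards0 ?addn0; last first.
  by apply/finset.setP => i; rewrite !inE !mxE oppr_lt0; case: ltgtP.
by apply: eq_card => i; rewrite !inE !mxE oppr_lt0; case: ltgtP.
Qed.

End SymmetricMatrices.

(** * Inertia under congruence, sums and block elimination *)

Section InertiaTheory.
Variable R : realType.

Lemma qformD n (A B : 'M[R]_n) x : qform (A + B) x = qform A x + qform B x.
Proof. by rewrite /qform mulmxDr mulmxDl mxE. Qed.

Lemma qformN n (A : 'M[R]_n) x : qform (- A) x = - qform A x.
Proof. by rewrite /qform mulmxN mulNmx mxE. Qed.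

Lemma sym_congr m n (A : 'M[R]_n) (B : 'M[R]_(m, n)) :
  A^T = A -> (B *m A *m B^T)^T = B *m A *m B^T.
Proof. by move=> At; rewrite !trmx_mul trmxK At mulmxA. Qed.

(** The nonnegativity certificate of [A] pulls back along a rectangular [B], so the index can only
    drop. *)
Lemma ind_congr_le m n (A : 'M[R]_n) (B : 'M[R]_(m, n)) : A^T = A ->
  (ind (B *m A *m B^T) <= ind A)%N.
Proof.
move=> At; have [C pos] := ind_nonneg_kernel At.
apply: (@ind_le _ _ _ _ (B *m C)); first exact: sym_congr.
by move=> x xBC; rewrite qformM; apply: pos; rewrite -mulmxA.
Qed.

Lemma ind_congr n (A B : 'M[R]_n) : A^T = A -> B \in unitmx ->
  ind (B *m A *m B^T) = ind A.
Proof.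
move=> At uB; apply/eqP; rewrite eqn_leq ind_congr_le //=.
have {1}-> : A = invmx B *m (B *m A *m B^T) *m (invmx B)^T.
  rewrite !mulmxA mulVmx // mul1mx -mulmxA -trmx_mul mulVmx //.
  by rewrite trmx1 mulmx1.
by rewrite ind_congr_le // sym_congr.
Qed.

(** Intersecting the two nonnegativity spaces adds the numbers of equations. *)
Lemma ind_subadditive n (A B : 'M[R]_n) : A^T = A -> B^T = B ->
  (ind (A + B) <= ind A + ind B)%N.
Proof.
move=> At Bt; have [C1 pos1] := ind_nonneg_kernel At.
have [C2 pos2] := ind_nonneg_kernel Bt.
apply: (@ind_le _ _ _ _ (row_mx C1 C2)); first by rewrite linearD /= At Bt.
move=> x; rewrite mul_mx_row -(row_mx0 R 1) => /eq_row_mx [x1 x2].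
by rewrite qformD addr_ge0 ?pos1 ?pos2.
Qed.

Lemma sym_block m n (A : 'M[R]_m) (B : 'M[R]_n) (C : 'M[R]_(n, m)) :
  A^T = A -> B^T = B -> (block_mx A C^T C B)^T = block_mx A C^T C B.
Proof. by move=> At Bt; rewrite tr_block_mx trmxK At Bt. Qed.

Lemma ind_block_diag m n (A : 'M[R]_m) (B : 'M[R]_n) : A^T = A -> B^T = B ->
  ind (block_mx A 0 0 B) = (ind A + ind B)%N.
Proof.
move=> At Bt.
have Kt : (block_mx A 0 0 B)^T = block_mx A 0 0 B.
  by rewrite tr_block_mx !trmx0 At Bt.
apply/eqP; rewrite eqn_leq; apply/andP; split.
  have [C1 pos1] := ind_nonneg_kernel At.
  have [C2 pos2] := ind_nonneg_kernel Bt.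
  apply: (@ind_le _ _ _ _ (block_mx C1 0 0 C2)) => // x.
  rewrite -[x]hsubmxK mul_row_block !mulmx0 addr0 add0r -(row_mx0 R 1).
  move=> /eq_row_mx [x1 x2]; rewrite /qform mul_row_block !mulmx0 addr0 add0r.
  by rewrite tr_row_mx mul_row_col mxE addr_ge0 ?pos1 ?pos2.
have [B1 e1] := ind_negative_rows At; have [B2 e2] := ind_negative_rows Bt.
apply: (@ind_ge _ _ _ _ (block_mx B1 0 0 B2)) => // y y0.
rewrite -qformM tr_block_mx !mulmx_block !trmx0 !(mulmx0, mul0mx, addr0, add0r) e1 e2.
have -> : block_mx (- 1%:M) 0 0 (- 1%:M) = - 1%:M :> 'M[R]_(ind A + ind B).
  by rewrite (scalar_mx_block _ _ 1) opp_block_mx !oppr0.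
by rewrite qformN oppr_lt0 /qform mulmx1 row_norm_gt0.
Qed.

Lemma mpinvmx_sym n (A : 'M[R]_n) : A^T = A ->
  (mpinvmx A)^T = mpinvmx A /\ A *m mpinvmx A = mpinvmx A *m A.
Proof.
move=> At; have := mpinvmxP A; set M := mpinvmx A => -[ABA BAB ABt BAt].
have Bt : M^T = M.
  apply: (is_moore_penrose_unique (A := A)); last exact: mpinvmxP.
  split.
  - by rewrite -[RHS]At -[in RHS]ABA !trmx_mul At mulmxA.
  - by rewrite -[in RHS]BAB !trmx_mul At mulmxA.
  - by rewrite trmx_mul trmxK At -BAt trmx_mul At.
  - by rewrite trmx_mul trmxK At -ABt trmx_mul At.
by split=> //; rewrite -ABt trmx_mul Bt At.
Qed.

(** Subadditivity bounds the negative indices of [A + B] and of its opposite. Their sum is the rank,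
    and orthogonality makes the row spaces independent, so ranks add and both bounds are
    equalities. *)
Lemma ind_add_orthogonal n (A B : 'M[R]_n) : A^T = A -> B^T = B ->
  A *m B = 0 -> ind (A + B) = (ind A + ind B)%N.
Proof.
move=> At Bt AB.
have BA : B *m A = 0 by rewrite -[B]Bt -[A]At -trmx_mul AB trmx0.
have ABt : (A + B)^T = A + B by rewrite linearD /= At Bt.
have sub (C D : 'M[R]_n) : C^T = C -> C *m D = 0 -> (C <= (C + D)%R)%MS.
  move=> Ct CD; have [CKC _ CKt _] := mpinvmxP C.
  apply/submxP; exists (C *m mpinvmx C); rewrite mulmxDr CKC.
  by rewrite -CKt trmx_mul Ct -mulmxA CD mulmx0 addr0.
have rk : (\rank A + \rank B <= \rank (A + B)%R)%N.
  rewrite -mxrank_disjoint_sum; last first.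
    apply/eqP/rowV0P => x; rewrite sub_capmx => /andP[/submxP [u xu] /submxP [v xv]].
    apply/eqP; apply: contraT => /row_norm_gt0.
    by rewrite {1}xu xv trmx_mul Bt !mulmxA -[u *m A *m B]mulmxA AB mulmx0 mul0mx
      mxE ltxx.
  apply: mxrankS; rewrite addsmx_sub sub // addrC sub //.
have N (C : 'M[R]_n) : C^T = C -> (- C)^T = - C by move=> Ct; rewrite linearN /= Ct.
have := ind_subadditive At Bt; have := ind_subadditive (N _ At) (N _ Bt).
rewrite -opprD => i1 i2; apply/eqP; rewrite eqn_leq i2 /=.
rewrite -(leq_add2r (ind (- (A + B)))) (ind_addN ABt).
apply: leq_trans rk; rewrite -(ind_addN At) -(ind_addN Bt) addnACA.
by rewrite leq_add2l.
Qed.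

(** Changing the sign of one block is a congruence onto the opposite matrix, so the two indices
    agree and each is half of the rank. *)
Lemma ind_antidiag m n (N : 'M[R]_(m, n)) :
  ind (block_mx 0 N^T N 0) = \rank N.
Proof.
set K := block_mx _ _ _ _.
have Kt : K^T = K by apply: sym_block; rewrite trmx0.
have rK : \rank K = (\rank N + \rank N)%N.
  transitivity (\rank (block_mx N^T 0 0 N)); last first.
    by rewrite rank_diag_block_mx mxrank_tr.
  have e : block_mx N^T 0 0 N = K *m block_mx 0 1%:M 1%:M 0.
    by rewrite mulmx_block !(mulmx0, mul0mx, mulmx1, addr0, add0r).
  have e' : K = block_mx N^T 0 0 N *m block_mx 0 1%:M 1%:M 0.
    by rewrite mulmx_block !(mulmx0, mul0mx, mulmx1, addr0, add0r).
  by apply/eqP; rewrite eqn_leq {1}e' mxrankM_maxl e mxrankM_maxl.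
suff KN : ind (- K) = ind K.
  apply/eqP; rewrite -(inj_eq double_inj) -!addnn -rK -(ind_addN Kt).
  by rewrite KN.
pose D : 'M[R]_(n + m) := block_mx 1%:M 0 0 (- 1%:M).
have DK : D *m K *m D^T = - K.
  rewrite /D /K tr_block_mx !mulmx_block opp_block_mx linearN /= !trmx1 !trmx0.
  by rewrite !(mulmx0, mul0mx, mulmx1, mul1mx, addr0, add0r, mulNmx, mulmxN, oppr0).
rewrite -DK ind_congr // -row_free_unit; apply/row_freeP; exists D.
rewrite /D mulmx_block !(mulmx0, mul0mx, mulmx1, mul1mx, addr0, add0r, mulNmx).
by rewrite opprK -scalar_mx_block.
Qed.

(* Both sides are the negative index of [[B, B], [B, A]]: it is congruent to
   diag(B, A - B), and eliminating with the pseudoinverse of [A] turns it into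
   the sum of the mutually orthogonal matrices diag(V S V, A) and
   [[0, N^T], [N, 0]]. *)
Lemma ind_schur_pseudoinverse n (A B : 'M[R]_n) (K := mpinvmx A)
    (N := (1%:M - A *m K) *m B) (V := 1%:M - mpinvmx N *m N) :
  A^T = A -> B^T = B ->
  (ind B + ind (A - B) =
   ind A + \rank N + ind (V *m (B - B *m K *m B) *m V))%N.
Proof.
move=> At Bt; have [Kt AK] := mpinvmx_sym At.
have := mpinvmxP A; rewrite -/K in Kt AK * => -[AKA KAK _ _].
have := mpinvmxP N; rewrite {}/V; set M := mpinvmx N => -[NMN MNM NMt MNt].
set S := B - _; have St : S^T = S by rewrite linearB /= !trmx_mul Kt Bt mulmxA.
(* [E] is the orthogonal projection onto the row space of [N], and V = 1 - E. *)
have [E EE] : exists E, M *m N = E by exists (M *m N).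
have Et : E^T = E by rewrite -EE.
rewrite EE.
have AN : A *m N = 0.
  by rewrite /N mulmxA mulmxBr mulmx1 mulmxA -mulmxA AK mulmxA AKA subrr mul0mx.
have NE : N = B - A *m K *m B by rewrite /N mulmxBl mul1mx.
clearbody N; have NtE : N^T = B - B *m K *m A.
  by rewrite NE linearB /= !trmx_mul Kt At Bt mulmxA.
have unip (X : 'M[R]_n) : (block_mx 1%:M X 0 1%:M : 'M[R]_(n + n)) \in unitmx.
  by rewrite unitmxE det_ublock !det1 mulr1 unitr1.
have unil (X : 'M[R]_n) : (block_mx 1%:M 0 X 1%:M : 'M[R]_(n + n)) \in unitmx.
  by rewrite unitmxE det_lblock !det1 mulr1 unitr1.
have ABt : (A - B)^T = A - B by rewrite linearB /= At Bt.
rewrite -ind_block_diag // -[LHS](ind_congr _ (unil 1%:M)); last first.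
  by rewrite tr_block_mx !trmx0 Bt ABt.
set L := (X in ind X).
have {L}-> : L = block_mx B B^T B A.
  rewrite /L tr_block_mx !mulmx_block !trmx1 trmx0.
  by rewrite !(mulmx0, mul0mx, mulmx1, mul1mx, addr0, add0r) Bt addrC subrK.
(* This elimination removes from the off-diagonal blocks the part of [B] reachable through [A]; what
   is left is [N], which satisfies [A *m N = 0]. *)
rewrite -[LHS](ind_congr _ (unip (- (B *m K)))); last exact: sym_block.
set L := (X in ind X).
have {L}-> : L = block_mx S N^T N A.
  rewrite /L tr_block_mx !mulmx_block !trmx1 trmx0 linearN /= trmx_mul Kt Bt.
  rewrite !(mulmx0, mul0mx, mulmx1, mul1mx, addr0, add0r, mulmxN, mulNmx).
  rewrite NtE NE mulmxA; congr block_mx; last by rewrite mulmxA.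
  rewrite !mulmxBl -[B *m K *m A *m K]mulmxA -[B *m K *m _]mulmxA.
  by rewrite [K *m (A *m K)]mulmxA KAK subrr subr0.
(* [G] solves N^T G + G^T N = E S + S E - E S E = S - V S V with A G = 0. The factor 1/2 shares the
   term E S E between the two summands. *)
pose G := M^T *m (S - 2^-1 *: (S *m E)).
have AG : A *m G = 0.
  rewrite /G -[in M^T]MNM -mulmxA trmx_mul NMt.
  by rewrite !mulmxA AN !mul0mx.
have GtA : G^T *m A = 0 by rewrite -[A]At -trmx_mul AG trmx0.
have NtG : N^T *m G = E *m S - 2^-1 *: (E *m S *m E).
  by rewrite /G mulmxA -trmx_mul EE Et mulmxBr -scalemxAr mulmxA.
have GtN : G^T *m N = S *m E - 2^-1 *: (E *m S *m E).
  rewrite -[N]trmxK -trmx_mul NtG linearB /= linearZ /= !trmx_mul Et St.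
  by rewrite mulmxA.
rewrite -[LHS](ind_congr _ (unip (- G^T))); last exact: sym_block.
set L := (X in ind X); set T := _ *m S *m _.
have Tt : T^T = T.
  by rewrite /T !trmx_mul linearB /= trmx1 Et St mulmxA.
have Vt : (1%:M - E)^T = 1%:M - E by rewrite linearB /= trmx1 Et.
have NV : N *m (1%:M - E) = 0 by rewrite mulmxBr mulmx1 -EE mulmxA NMN subrr.
have {L}-> : L = block_mx T 0 0 A + block_mx 0 N^T N 0.
  rewrite /L tr_block_mx !mulmx_block !trmx1 trmx0 linearN /= trmxK.
  rewrite !(mulmx0, mul0mx, mulmx1, mul1mx, addr0, add0r, mulmxN, mulNmx).
  rewrite GtA oppr0 addr0 AG oppr0 ?add0r ?addr0 add_block_mx !(addr0, add0r).
  congr block_mx.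
  have -> : T = S - E *m S - (S *m E - E *m S *m E).
    by rewrite /T mulmxBr mulmx1 mulmxBl mul1mx mulmxBl.
  rewrite NtG GtN; move: (E *m S *m E) (E *m S) (S *m E) => Z X W.
  by apply/matrixP => i j; rewrite !mxE; field.
rewrite ind_add_orthogonal.
- by rewrite ind_block_diag // ind_antidiag; lia.
- by rewrite tr_block_mx !trmx0 Tt At.
- by apply: sym_block; rewrite trmx0.
have TN : T *m N^T = 0.
  rewrite /T -mulmxA -[X in _ *m X]trmxK trmx_mul trmxK Vt NV.
  by rewrite trmx0 mulmx0.
by rewrite mulmx_block !(mulmx0, mul0mx, addr0, add0r) TN AN block_mx0.
Qed.

Lemma mpinvmxN m n (A : 'M[R]_(m, n)) : mpinvmx (- A) = - mpinvmx A.
Proof.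
have := mpinvmxP A; set M := mpinvmx A => -[AMA MAM AMt MAt].
apply: (is_moore_penrose_unique (A := - A)); first exact: mpinvmxP.
by split; rewrite !(mulmxN, mulNmx) ?opprK ?AMA ?MAM.
Qed.

Lemma ind_schur_pseudoinverseN n (A B : 'M[R]_n) (K := mpinvmx A)
    (N := (1%:M - A *m K) *m B) (V := 1%:M - mpinvmx N *m N) :
  A^T = A -> B^T = B ->
  (ind (- B) + ind (- (A - B)) =
   ind (- A) + \rank N + ind (- (V *m (B - B *m K *m B) *m V)))%N.
Proof.
move=> At Bt; have t (C : 'M[R]_n) : C^T = C -> (- C)^T = - C.
  by move=> Ct; rewrite linearN /= Ct.
rewrite (_ : - (A - B) = - A - - B) ?opprD // ind_schur_pseudoinverse ?t //
  mpinvmxN -/K.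
have -> : - B - - B *m - K *m - B = - (B - B *m K *m B).
  by rewrite !(mulmxN, mulNmx) !opprK opprB addrC.
rewrite !(mulmxN, mulNmx) opprK -/N mpinvmxN !(mulmxN, mulNmx) opprK -/V.
by rewrite eqmx_opp.
Qed.

(* The comparative index of two planes is written in terms of the symmetric
   matrices [A] and [B] of which they are the graphs: [X = A *m W] and
   [Xh = B *m T] are the upper blocks. *)
Lemma cind_blocks n (A B W T : 'M[R]_n) (X := A *m W)
    (w := W^T *m (A - B) *m T)
    (M := (1%:M - mpinvmx X *m X) *m w) (V := 1%:M - mpinvmx M *m M)
    (P := V *m w^T *m mpinvmx X *m (B *m T) *m V)
    (K := mpinvmx A) (N := (1%:M - A *m K) *m B)
    (V2 := 1%:M - mpinvmx N *m N)
    (P2 := V2 *m (B - B *m K *m B) *m V2) :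
  A^T = A -> B^T = B -> W \in unitmx -> T \in unitmx ->
  [/\ \rank M = \rank N, ind P = ind P2 & ind (- P) = ind (- P2)].
Proof.
move=> At Bt uW uT; have [Kt AK] := mpinvmx_sym At; rewrite -/K in Kt AK.
have [AKA KAK _ _] := mpinvmxP A; rewrite -/K in AKA KAK.
have eX : X = A *m W by []; have ew : w = W^T *m (A - B) *m T by [].
have eN : N = (1%:M - A *m K) *m B by [].
have eM : M = (1%:M - mpinvmx X *m X) *m w by [].
have MV : M *m V = 0.
  by have [e _ _ _] := mpinvmxP M; rewrite mulmxBr mulmx1 mulmxA e subrr.
have NV2 : N *m V2 = 0.
  by have [e _ _ _] := mpinvmxP N; rewrite mulmxBr mulmx1 mulmxA e subrr.
have Vt : V^T = V.
  by have [_ _ _ e] := mpinvmxP M; rewrite linearB /= trmx1 e.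
have V2t : V2^T = V2.
  by have [_ _ _ e] := mpinvmxP N; rewrite linearB /= trmx1 e.
have eV : V = 1%:M - mpinvmx M *m M by [].
have eV2 : V2 = 1%:M - mpinvmx N *m N by [].
have eP : P = V *m w^T *m mpinvmx X *m (B *m T) *m V by [].
have eP2 : P2 = V2 *m (B - B *m K *m B) *m V2 by [].
clearbody P P2 V V2 M N w X K.
have [XGX _ _ GXt] := mpinvmxP X; move: eM eP XGX GXt.
move: (mpinvmx X) => G eM eP XGX GXt.
(* Through [H] and [H'] the matrices [M] and [N *m T] are left multiples of each other. They thus
   share rank and kernel, although they come from pseudoinverses of different matrices. *)
have [H eH] : exists H, (1%:M - G *m X) *m W^T = H by eexists.
have [H' eH'] : exists H', (1%:M - A *m K) *m invmx W^T = H' by eexists.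
have uWt : W^T \in unitmx by rewrite unitmx_tr.
have Xt : X^T = W^T *m A by rewrite eX trmx_mul At.
have HA : H *m A = 0.
  rewrite -eH -mulmxA -Xt mulmxBl mul1mx -GXt -trmx_mul.
  by rewrite mulmxA XGX subrr.
have NE : B = A *m K *m B + N by rewrite eN mulmxBl mul1mx addrC subrK.
have MHN : M = - (H *m N *m T).
  rewrite eM ew !mulmxA eH mulmxBr HA sub0r {1}NE mulmxDr !mulmxA HA !mul0mx.
  by rewrite add0r mulNmx.
have AK_A : (1%:M - A *m K) *m A = 0 by rewrite mulmxBl mul1mx AKA subrr.
have AK_N : (1%:M - A *m K) *m N = N.
  by rewrite eN mulmxA mulmxBr mulmx1 mulmxA AK_A mul0mx subr0.
have NTH : N *m T = - (H' *m M).
  rewrite MHN mulmxN opprK !mulmxA; congr (_ *m _).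
  rewrite -eH mulmxA mulmxBr mulmx1 mulmxBl -eH' -[_ *m invmx W^T *m W^T]mulmxA.
  rewrite mulVmx // mulmx1 mulmxBl AK_N -GXt trmx_mul Xt !mulmxA.
  rewrite -[_ *m invmx W^T *m W^T]mulmxA mulVmx // mulmx1 AK_A !mul0mx.
  by rewrite subr0.
have NTV : N *m (T *m V) = 0 by rewrite mulmxA NTH mulNmx -mulmxA MV mulmx0 oppr0.
have V2TV : V2 *m (T *m V) = T *m V.
  by rewrite eV2 mulmxBl mul1mx -mulmxA NTV mulmx0 subr0.
have MTV2 : M *m (invmx T *m V2) = 0.
  rewrite MHN mulNmx mulmxA -[_ *m T *m invmx T]mulmxA mulmxV // mulmx1.
  by rewrite -mulmxA NV2 mulmx0 oppr0.
have VTV2 : V *m (invmx T *m V2) = invmx T *m V2.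
  by rewrite eV mulmxBl mul1mx -mulmxA MTV2 mulmx0 subr0.
pose S := B - B *m K *m B.
have St : S^T = S by rewrite linearB /= !trmx_mul Kt Bt mulmxA.
have P2t : P2^T = P2 by rewrite eP2 !trmx_mul V2t -/S St mulmxA.
have BTV : B *m (T *m V) = A *m K *m B *m (T *m V).
  by rewrite {1}NE mulmxDl NTV addr0.
have GA : A *m W *m G *m A = A.
  move: XGX; rewrite eX mulmxA => /(congr1 (mulmx^~ (invmx W))).
  by rewrite -!mulmxA mulmxV // !mulmx1 !mulmxA.
(* On the range of [T *m V] the image of [B] lies in that of [A]. There only the inner-inverse
   equation of [G] matters, and [G] can be traded for [K]. *)
have PE : P = (T *m V)^T *m S *m (T *m V).
  have -> : P = (T *m V)^T *m (A - B) *m W *m G *m (B *m (T *m V)).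
    by rewrite eP ew !trmx_mul trmxK linearB /= At Bt Vt !mulmxA.
  move: (T *m V) BTV => Q BQ.
  have QB : Q^T *m B = Q^T *m B *m K *m A.
    by have := congr1 trmx BQ; rewrite !trmx_mul Bt Kt At !mulmxA.
  have f1 : A *m W *m G *m (B *m Q) = B *m Q by rewrite BQ !mulmxA GA.
  rewrite mulmxBr !mulmxBl QB -[_ *m A *m W]mulmxA -[_ *m (A *m W) *m G]mulmxA.
  rewrite -[_ *m (A *m W *m G) *m _]mulmxA f1 -[_ *m A *m W]mulmxA.
  rewrite -[_ *m (A *m W) *m G]mulmxA -[_ *m (A *m W *m G) *m _]mulmxA f1.
  by rewrite /S mulmxBr mulmxBl !mulmxA.
have eP_P2 : P = (T *m V)^T *m P2 *m (T *m V).
  have V2Q : (T *m V)^T *m V2 = (T *m V)^T.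
    by rewrite -[in RHS]V2TV [in RHS]trmx_mul V2t.
  by rewrite PE eP2 -/S -!mulmxA V2TV !mulmxA V2Q.
have eP2_P : P2 = (invmx T *m V2)^T *m P *m (invmx T *m V2).
  have V2E : T *m V *m (invmx T *m V2) = V2.
    by rewrite -mulmxA VTV2 mulKVmx.
  by rewrite PE -!mulmxA [T *m (V *m _)]mulmxA V2E mulmxA -trmx_mul V2E V2t eP2 mulmxA.
have Pt : P^T = P.
  by rewrite eP_P2 -[X in _ *m X]trmxK sym_congr.
(* Congruences in both directions force equal indices even when the two factors are singular. *)
have ind_eq (C : 'M[R]_n) (D : 'M[R]_n) (F1 F2 : 'M[R]_n) : C^T = C -> D^T = D ->
    C = F1^T *m D *m F1 -> D = F2^T *m C *m F2 -> ind C = ind D.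
  move=> Ct Dt eC eD; apply/eqP; rewrite eqn_leq; apply/andP; split.
    by rewrite eC -[X in _ *m X]trmxK ind_congr_le.
  by rewrite eD -[X in _ *m X]trmxK ind_congr_le.
split.
- apply/eqP; rewrite eqn_leq; apply/andP; split.
    by rewrite MHN eqmx_opp -mulmxA (leq_trans (mxrankM_maxr _ _)) // mxrankM_maxl.
  by rewrite -(mxrankMfree N (B := T)) ?row_free_unit // NTH eqmx_opp mxrankM_maxr.
- exact: ind_eq eP_P2 eP2_P.
apply: (@ind_eq _ _ (T *m V) (invmx T *m V2)).
- by rewrite linearN /= Pt.
- by rewrite linearN /= P2t.
- by rewrite mulmxN mulNmx -eP_P2.
- by rewrite mulmxN mulNmx -eP2_P.
Qed.

End InertiaTheory.

(** * Lagrangian planes as graphs *)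

Section Charts.
Variables (R : realType) (n : nat).
Implicit Types (Y Z : 'M[R]_(n + n, n)) (q : R).

(* A plane transversal to the image of [col_mx 1%:M q%:M] is, in the coordinates
   (X, U - q X), the graph of the symmetric matrix [chart q Y]. *)
Definition chart_den q Y : 'M[R]_n := dsubmx Y - q *: usubmx Y.

Definition chart q Y : 'M[R]_n := usubmx Y *m invmx (chart_den q Y).

Lemma wronskianE Y Z :
  wronskian Y Z = (usubmx Y)^T *m dsubmx Z - (dsubmx Y)^T *m usubmx Z.
Proof.
rewrite /wronskian /Jmx -{1}[Y]vsubmxK -{1}[Z]vsubmxK tr_col_mx.
rewrite mul_row_block mul_row_col !mulmx0 add0r addr0 mulmx1 mulmxN mulmx1.
by rewrite mulNmx addrC.
Qed.

Lemma wronskian_tr Y Z : (wronskian Y Z)^T = - wronskian Z Y.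
Proof. by rewrite !wronskianE linearB /= !trmx_mul !trmxK opprB. Qed.

Lemma tr_chart_den q Y :
  (chart_den q Y)^T = (dsubmx Y)^T - q *: (usubmx Y)^T.
Proof. by rewrite linearB linearZ. Qed.

(** Replacing (X, U) by (X, U - q X) is a symplectic change of coordinates, so the Wronskian keeps
    its form. *)
Lemma wronskian_den q Y Z : wronskian Y Z =
  (usubmx Y)^T *m chart_den q Z - (chart_den q Y)^T *m usubmx Z.
Proof.
rewrite wronskianE tr_chart_den /chart_den mulmxBr mulmxBl.
by rewrite -scalemxAl -scalemxAr opprB addrA subrK.
Qed.

Lemma usubmx_chart q Y : chart_den q Y \in unitmx ->
  usubmx Y = chart q Y *m chart_den q Y.
Proof. by move=> uY; rewrite /chart mulmxKV. Qed.

Lemma rank_chart q Y : chart_den q Y \in unitmx ->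
  \rank (chart q Y) = \rank (usubmx Y).
Proof.
by move=> uY; rewrite [in RHS](usubmx_chart uY) [RHS]mxrankMfree ?row_free_unit.
Qed.

Lemma chart_sym q Y : lagrangian Y -> chart_den q Y \in unitmx ->
  (chart q Y)^T = chart q Y.
Proof.
move=> [YJY _] uY; have : wronskian Y Y = 0 by [].
rewrite (wronskian_den q) => /eqP; rewrite subr_eq0 => /eqP e.
have uYt : (chart_den q Y)^T \in unitmx by rewrite unitmx_tr.
rewrite /chart trmx_mul trmx_inv.
apply: (can_inj (mulKmx uYt)); apply: (can_inj (mulmxK uY)).
by rewrite mulKVmx // e -!mulmxA mulVmx // mulmx1.
Qed.

Lemma wronskian_chart q Y Z : lagrangian Y ->
  chart_den q Y \in unitmx -> chart_den q Z \in unitmx ->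
  wronskian Y Z =
    (chart_den q Y)^T *m (chart q Y - chart q Z) *m chart_den q Z.
Proof.
move=> lY uY uZ; rewrite (wronskian_den q) (usubmx_chart uY) (usubmx_chart uZ).
rewrite trmx_mul chart_sym //; move: (chart q Y) (chart q Z) => A B.
move: (chart_den q Y) (chart_den q Z) => W T.
by rewrite mulmxBr mulmxBl mulmxA.
Qed.

(** The source of monotonicity: an increment of the chart is a Wronskian between invertible factors,
    so a difference quotient of the chart involves only a quotient of [Y]. *)
Lemma chart_sub q Y Z : lagrangian Y ->
  chart_den q Y \in unitmx -> chart_den q Z \in unitmx ->
  chart q Y - chart q Z =
    (invmx (chart_den q Y))^T *m wronskian Y Z *m invmx (chart_den q Z).
Proof.
move=> lY uY uZ; rewrite (@wronskian_chart q) // trmx_inv !mulmxA.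
by rewrite mulVmx ?unitmx_tr // mul1mx mulmxK.
Qed.

Lemma rank_wronskian q Y Z : lagrangian Y ->
  chart_den q Y \in unitmx -> chart_den q Z \in unitmx ->
  \rank (wronskian Y Z) = \rank (chart q Y - chart q Z).
Proof.
move=> lY uY uZ; rewrite (@wronskian_chart q) // mxrankMfree ?row_free_unit //.
by rewrite eqmxMfull // row_full_unit unitmx_tr.
Qed.

(** Stated additively because the indices are natural numbers. *)
Lemma cind_chart q Y Z : lagrangian Y -> lagrangian Z ->
  chart_den q Y \in unitmx -> chart_den q Z \in unitmx ->
  (cind Y Z + ind (chart q Y) =
     ind (chart q Z) + ind (chart q Y - chart q Z))%N /\
  (dual_cind Y Z + ind (- chart q Y) =
     ind (- chart q Z) + ind (- (chart q Y - chart q Z)))%N.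
Proof.
move=> lY lZ uY uZ; have At := chart_sym lY uY; have Bt := chart_sym lZ uZ.
have := cind_blocks At Bt uY uZ.
rewrite -(wronskian_chart lY uY uZ) -(usubmx_chart uY) -(usubmx_chart uZ).
move=> [rM iP iPN].
have := ind_schur_pseudoinverse At Bt; rewrite -rM -iP => e.
have := ind_schur_pseudoinverseN At Bt; rewrite -rM -iPN => eN.
split; [rewrite e | rewrite eN]; rewrite -[LHS]addnC addnA;
  by rewrite /cind /dual_cind /cindP /cindV /cindM.
Qed.

(** Degenerate parameters behave like eigenvalues of a symmetric problem: kernel vectors for
    distinct parameters have nonzero, mutually orthogonal images under X^T, and these live in
    dimension n. *)
Lemma chart_den_bad_bound k (s : 'I_k -> R) Y : injective s -> lagrangian Y ->
  (forall i, chart_den (s i) Y \notin unitmx) -> (k <= n)%N.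
Proof.
move=> s_inj [YJY rY] bad.
have /choice [v vP] : forall i, exists u : 'rV[R]_n,
    u != 0 /\ u *m (chart_den (s i) Y)^T = 0.
  move=> i; have := bad i; rewrite -unitmx_tr -row_free_unit -kermx_eq0.
  by case/rowV0Pn => u /sub_kermxP uK u0; exists u.
set X := usubmx Y; set U := dsubmx Y.
pose V := \matrix_(i < k) v i; pose N := V *m X^T.
pose D := diag_mx (\row_i s i).
have VU : V *m U^T = D *m N.
  apply/row_matrixP => i; rewrite /N !mulmxA !row_mul row_diag_mx -!scalemxAl.
  rewrite -rowE rowK mxE; have [_] := vP i.
  rewrite tr_chart_den mulmxBr -scalemxAr => /eqP.
  by rewrite subr_eq0 => /eqP.
(* Isotropy of [Y], in the form X^T U = U^T X, makes the Gram matrix commute with [D]. Since [D] has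
   distinct entries, the Gram matrix is diagonal. *)
have comm : N *m N^T *m D = D *m (N *m N^T).
  have e : X^T *m U = U^T *m X.
    by apply/eqP; rewrite -subr_eq0 -wronskianE; apply/eqP.
  have NtD : N^T *m D = (D *m N)^T by rewrite [RHS]trmx_mul tr_diag_mx.
  rewrite -mulmxA NtD [RHS]mulmxA -VU [(V *m U^T)^T]trmx_mul trmxK /N trmx_mul
    trmxK !mulmxA.
  by rewrite -[V *m _ *m U]mulmxA e mulmxA.
have Nrow i : row i N != 0.
  apply/negP => /eqP; rewrite row_mul rowK => vX0.
  have [v0] := vP i; rewrite tr_chart_den mulmxBr -scalemxAr.
  rewrite -/X vX0 scaler0 subr0 => vU0; move/negP: v0; apply.
  have : v i *m Y^T = 0.
    by rewrite -[Y]vsubmxK tr_col_mx mul_mx_row vX0 vU0 row_mx0.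
  have fY : row_free Y^T by rewrite /row_free mxrank_tr rY.
  by rewrite -(mul0mx _ Y^T) => /(row_free_inj fY) ->.
have NN : N *m N^T = diag_mx (\row_i (N *m N^T) i i).
  apply/matrixP => i j; rewrite [RHS]mxE [in RHS]mxE; have [->|ij] := eqVneq i j.
    by rewrite mulr1n.
  have /matrixP/(_ i j) := comm; rewrite /D mul_mx_diag mul_diag_mx mxE [RHS]mxE.
  rewrite !mxE mulrC => /eqP; rewrite -subr_eq0 -mulrBl mulf_eq0 subr_eq0.
  by rewrite (inj_eq s_inj) eq_sym (negbTE ij) => /eqP.
have : \rank (N *m N^T) = k.
  rewrite NN rank_diag_mx -[RHS]card_ord; apply: eq_card => i.
  rewrite !inE mxE gt_eqF //; have := row_norm_gt0 (Nrow i).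
  have -> // : (row i N *m (row i N)^T) 0 0 = (N *m N^T) i i.
  by rewrite mxE [RHS]mxE; apply: eq_bigr => j _; rewrite ![_^T _ _]mxE ![row _ _ _
    _]mxE.
by move=> <-; rewrite (leq_trans (mxrankM_maxl _ _)) // rank_leq_col.
Qed.

(** Each plane excludes at most n of the 2 n + 1 parameters 0, ..., 2 n, so one of them serves
    both. *)
Lemma common_chart Y Z : lagrangian Y -> lagrangian Z ->
  exists q, chart_den q Y \in unitmx /\ chart_den q Z \in unitmx.
Proof.
move=> lY lZ.
pose S Y' := [set i : 'I_(n + n).+1 | chart_den (i%:R : R) Y' \notin unitmx]%SET.
have card_S Y' : lagrangian Y' -> (#|S Y'| <= n)%N.
  move=> lY'; apply: (@chart_den_bad_bound _ (fun i => (enum_val i : 'I__)%:R) Y')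
    => //.
    by move=> i j /eqP; rewrite eqr_nat => /eqP/val_inj/enum_val_inj.
  by move=> i; have := enum_valP i; rewrite inE.
have : (#|S Y :|: S Z| < #|'I_(n + n).+1|)%N.
  rewrite card_ord ltnS cardsU (leq_trans (leq_subr _ _)) //.
  by rewrite leq_add ?card_S.
case: (pickP [pred i | i \notin S Y :|: S Z]) => [i|inS].
  rewrite !inE negb_or !negbK => /andP[uY uZ] _; by exists i%:R.
by rewrite (eq_card (B := predT)) ?ltnn // => i; apply/negbFE; exact: inS.
Qed.

(** Completes the plane spanned by (I; q I) to a symplectic matrix. The Wronskian of that plane with
    [Y] is [chart_den q Y], and its upper block is the identity, so a constant shear is admissible
    wherever the chart is. *)
Definition shear q : 'M[R]_(n + n) := block_mx 0 1%:M (- 1%:M) q%:M.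

Lemma shear_symplectic q : symplectic (shear q).
Proof.
rewrite /symplectic /shear /Jmx tr_block_mx !mulmx_block linearN /= !trmx1 trmx0.
rewrite tr_scalar_mx !(mulmx0, mul0mx, mulmx1, mul1mx, addr0, add0r, mulmxN, mulNmx).
by rewrite addNr oppr0 raddfN /= trmx1 opprK.
Qed.

Lemma shearE q : shear q *m Emx R n = col_mx 1%:M q%:M.
Proof.
by rewrite /shear /Emx mul_block_col !(mulmx0, mulmx1, addr0, add0r).
Qed.

Lemma wronskian_shear q Y : wronskian (shear q *m Emx R n) Y = chart_den q Y.
Proof.
by rewrite shearE wronskianE col_mxKu col_mxKd trmx1 tr_scalar_mx mul1mx mul_scalar_mx.
Qed.

Lemma upper_block (S : 'M[R]_(n + n)) : row_mx 1%:M 0 *m S *m Emx R n = usubmx (S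
  *m Emx R n).
Proof.
rewrite -mulmxA -{1}[S *m _]vsubmxK mul_row_col mul1mx mul0mx addr0.
by [].
Qed.

Lemma symplectic_lagrangian (S : 'M[R]_(n + n)) : symplectic S -> lagrangian (S *m
  Emx R n).
Proof.
move=> SJS; split.
  rewrite trmx_mul !mulmxA -[_ *m S^T *m _]mulmxA -[_ *m (S^T *m _) *m S]mulmxA SJS.
  rewrite /Emx /Jmx tr_col_mx mul_row_block mul_row_col trmx1 trmx0.
  by rewrite !(mulmx0, mul0mx, addr0, add0r).
have uJ : Jmx R n \in unitmx.
  have : Jmx R n *m (- Jmx R n) = 1%:M.
    rewrite /Jmx opp_block_mx mulmx_block.
    rewrite !(mulmx0, mul0mx, mulmx1, mul1mx, addr0, add0r, mulmxN, mulNmx).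
    by rewrite ?oppr0 ?opprK ?(mulmx0, addr0, add0r) -scalar_mx_block.
  by case/mulmx1_unit.
have uS : S \in unitmx.
  by move: uJ; rewrite -SJS !unitmxE det_mulmx unitrM => /andP[].
rewrite eqmxMfull ?row_full_unit //.
have : \rank (row_mx (0 : 'M[R]_n) (1%:M : 'M[R]_n)) = n.
  by rewrite rank_row_0mx mxrank1.
by rewrite -mxrank_tr tr_row_mx trmx0 trmx1.
Qed.

End Charts.

(** * One-sided limits of matrices *)

Section MatrixLimits.
Variables (R : realType) (T : Type) (F : set_system T).
Context {FF : ProperFilter F}.

(** Entrywise, along an arbitrary filter: products, determinants and inverses reduce to scalar
    limits, and one set of lemmas serves one-sided limits and difference quotients alike. *)
Definition mx_cvg m n (A : T -> 'M[R]_(m, n)) (L : 'M[R]_(m, n)) : Prop :=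
  forall i j, A t i j @[t --> F] --> L i j.

Lemma cvg_mx_cvg m n (A : T -> 'M[R]_(m, n)) (L : 'M[R]_(m, n)) :
  A t @[t --> F] --> L -> mx_cvg A L.
Proof.
move=> AL i j.
exact: (continuous_cvg _ (@coord_continuous R m n i j L) AL).
Qed.

Lemma cvg_bigsum I (r : seq I) (P : pred I) (f : I -> T -> R) (l : I -> R) :
  (forall i, f i t @[t --> F] --> l i) ->
  (\sum_(i <- r | P i) f i t) @[t --> F] --> \sum_(i <- r | P i) l i.
Proof.
move=> fl; elim: r => [|x r IH].
  by under eq_cvg do rewrite big_nil; rewrite big_nil; exact: cvg_cst.
under eq_cvg do rewrite big_cons; rewrite big_cons.
by case: (P x) => //; apply: cvgD.
Qed.

Lemma cvg_bigprod I (r : seq I) (P : pred I) (f : I -> T -> R) (l : I -> R) :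
  (forall i, f i t @[t --> F] --> l i) ->
  (\prod_(i <- r | P i) f i t) @[t --> F] --> \prod_(i <- r | P i) l i.
Proof.
move=> fl; elim: r => [|x r IH].
  by under eq_cvg do rewrite big_nil; rewrite big_nil; exact: cvg_cst.
under eq_cvg do rewrite big_cons; rewrite big_cons.
by case: (P x) => //; apply: cvgM.
Qed.

Lemma mx_cvg_cst m n (L : 'M[R]_(m, n)) : mx_cvg (fun=> L) L.
Proof. by move=> i j; exact: cvg_cst. Qed.

Lemma mx_cvgM m n p (A : T -> 'M[R]_(m, n)) (B : T -> 'M[R]_(n, p)) LA LB :
  mx_cvg A LA -> mx_cvg B LB -> mx_cvg (fun t => A t *m B t) (LA *m LB).
Proof.
move=> AL BL i j; rewrite mxE; under eq_cvg do rewrite mxE.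
by apply: cvg_bigsum => k; apply: cvgM.
Qed.

Lemma mx_cvg_qform n (A : T -> 'M[R]_n) L x :
  mx_cvg A L -> qform (A t) x @[t --> F] --> qform L x.
Proof.
move=> AL; have c : mx_cvg (fun t => x *m A t *m x^T) (x *m L *m x^T).
  by apply: mx_cvgM; [apply: mx_cvgM => //|]; exact: mx_cvg_cst.
exact: c.
Qed.

Lemma mx_cvgB m n (A B : T -> 'M[R]_(m, n)) LA LB :
  mx_cvg A LA -> mx_cvg B LB -> mx_cvg (fun t => A t - B t) (LA - LB).
Proof.
move=> AL BL i j; rewrite !mxE; under eq_cvg do rewrite !mxE.
exact: cvgB.
Qed.

Lemma mx_cvgN m n (A : T -> 'M[R]_(m, n)) LA :
  mx_cvg A LA -> mx_cvg (fun t => - A t) (- LA).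
Proof.
move=> AL i j; rewrite !mxE; under eq_cvg do rewrite !mxE.
exact: cvgN.
Qed.

Lemma mx_cvg_tr m n (A : T -> 'M[R]_(m, n)) LA :
  mx_cvg A LA -> mx_cvg (fun t => (A t)^T) LA^T.
Proof.
by move=> AL i j; rewrite mxE; under eq_cvg do rewrite mxE; exact: AL.
Qed.

Lemma mx_cvg_det n (A : T -> 'M[R]_n) L :
  mx_cvg A L -> \det (A t) @[t --> F] --> \det L.
Proof.
move=> AL; apply: cvg_bigsum => s; apply: cvgM; first exact: cvg_cst.
exact: cvg_bigprod.
Qed.

Lemma mx_cvg_unitmx n (A : T -> 'M[R]_n) L :
  mx_cvg A L -> L \in unitmx -> \forall t \near F, A t \in unitmx.
Proof.
move=> /mx_cvg_det dL; rewrite unitmxE unitfE => /(cvgr_neq0 _ dL) nz.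
by apply: filterS nz => t; rewrite unitmxE unitfE.
Qed.

Lemma mx_cvg_inv n (A : T -> 'M[R]_n) L :
  mx_cvg A L -> L \in unitmx -> mx_cvg (fun t => invmx (A t)) (invmx L).
Proof.
move=> AL uL i j; rewrite /invmx uL mxE.
(* Near the limit the matrices are invertible, so the inverse is the adjugate over the determinant
   and the default value of [invmx] does not occur. *)
apply: cvg_trans.
  apply: (near_eq_cvg (f := fun t => (\det (A t))^-1 * (\adj (A t)) i j)).
  by apply: filterS (mx_cvg_unitmx AL uL) => t uA; rewrite uA [RHS]mxE.
apply: cvgM; first apply: cvgV; first by rewrite -unitfE -unitmxE.
  exact: mx_cvg_det.
rewrite mxE /cofactor; under eq_cvg do rewrite mxE /cofactor.
apply: cvgM; first exact: cvg_cst.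
apply: mx_cvg_det => k l; rewrite !mxE; under eq_cvg do rewrite !mxE.
exact: AL.
Qed.

Lemma mx_cvg_chart_den n q (Y : T -> 'M[R]_(n + n, n)) L :
  mx_cvg Y L -> mx_cvg (fun t => chart_den q (Y t)) (chart_den q L).
Proof.
move=> YL i j; rewrite !mxE; under eq_cvg do rewrite !mxE.
by apply: cvgB; [|apply: cvgM; [exact: cvg_cst|]]; exact: YL.
Qed.

Lemma mx_cvg_chart n q (Y : T -> 'M[R]_(n + n, n)) L :
  mx_cvg Y L -> chart_den q L \in unitmx ->
  mx_cvg (fun t => chart q (Y t)) (chart q L).
Proof.
move=> YL uL; apply: mx_cvgM; last exact: mx_cvg_inv (mx_cvg_chart_den YL) uL.
by move=> i j; rewrite !mxE; under eq_cvg do rewrite !mxE; exact: YL.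
Qed.

(** With entrywise error below 1/(k+1), the bound 2 |y_i y_j| <= y_i^2 + y_j^2 gives an error of at
    most k/(k+1) times the squared norm, which cannot offset minus the identity. *)
Lemma qform_near_opp1 k (D : 'M[R]_k) (y : 'rV[R]_k) :
  (forall i j, `|D i j - (- 1%:M : 'M[R]_k) i j| < k.+1%:R^-1) -> y != 0 ->
  qform D y < 0.
Proof.
move=> De y0; pose E := D + 1%:M; pose s := (y *m y^T) 0 0.
have s0 : 0 < s := row_norm_gt0 y0.
have sE : s = \sum_i y 0 i ^+ 2.
  by rewrite /s mxE; apply: eq_bigr => i _; rewrite mxE expr2.
have -> : D = E - 1%:M by rewrite addrK.
rewrite qformD qformN {2}/qform mulmx1 -/s subr_lt0.
have EE : qform E y = \sum_j \sum_i y 0 i * E i j * y 0 j.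
  rewrite /qform mxE; apply: eq_bigr => j _.
  by rewrite mxE [y^T _ _]mxE mulr_suml.
have b i j : y 0 i * E i j * y 0 j <= k.+1%:R^-1 * 2^-1 * (y 0 i ^+ 2 + y 0 j ^+ 2).
  have e : `|E i j| <= k.+1%:R^-1 by have := ltW (De i j); rewrite !mxE opprK.
  apply: le_trans (ler_norm _) _; rewrite mulrAC normrM mulrC -mulrA.
  apply: ler_pM => //.
  rewrite normrM.
  have := sqr_ge0 (`|y 0 i| - `|y 0 j|).
  by rewrite sqrrB !real_normK ?num_real // mulr2n; lra.
rewrite EE; apply: (@le_lt_trans _ _ (k%:R * (k.+1%:R^-1 * s))).
  apply: le_trans (ler_sum _ (fun j _ => ler_sum _ (fun i _ => b i j))) _.
  under eq_bigr do rewrite -mulr_sumr big_split /= -sE sumr_const card_ord.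
  rewrite -mulr_sumr big_split /= sumr_const card_ord sumrMnl -sE -[s *+ k]mulr_natl.
  by set c := k.+1%:R^-1; lra.
rewrite mulrA -ltr_pdivlMr // divff ?gt_eqF // ltr_pdivrMr ?ltr0Sn //.
by rewrite mul1r ltr_nat.
Qed.

(** A frame on which [L] is minus the identity stays negative for nearby matrices. *)
Lemma ind_lower_semicontinuous n (A : T -> 'M[R]_n) L :
  mx_cvg A L -> L^T = L -> (\forall t \near F, (A t)^T = A t) ->
  \forall t \near F, (ind L <= ind (A t))%N.
Proof.
move=> AL Lt At; have [B eB] := ind_negative_rows Lt.
have D : mx_cvg (fun t => B *m A t *m B^T) (- 1%:M).
  rewrite -eB; apply: mx_cvgM; last exact: mx_cvg_cst.
  by apply: mx_cvgM => //; exact: mx_cvg_cst.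
have : \forall t \near F, forall i j,
    `|(B *m A t *m B^T) i j - (- 1%:M : 'M[R]_(ind L)) i j| < (ind L).+1%:R^-1.
  apply: filter_forall => i; apply: filter_forall => j.
  have e0 : 0 < (ind L).+1%:R^-1 :> R by rewrite invr_gt0.
  by apply: filterS (cvgr_dist_lt _ _ (D i j) _ e0) => t; rewrite distrC.
apply: filterS2 At => t At nearD; apply: ind_ge At _ => y y0.
by rewrite -qformM; exact: qform_near_opp1.
Qed.

(** Semicontinuity bounds both indices from below, and their sum is the fixed rank, so neither can
    exceed its limit value. *)
Lemma ind_near_constant_rank n (A : T -> 'M[R]_n) L :
  mx_cvg A L -> L^T = L -> (\forall t \near F, (A t)^T = A t) ->
  (\forall t \near F, \rank (A t) = \rank L) ->
  \forall t \near F, ind (A t) = ind L /\ ind (- A t) = ind (- L).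
Proof.
move=> AL Lt At rA.
have NLt : (- L)^T = - L by rewrite linearN /= Lt.
have NAt : \forall t \near F, (- A t)^T = - A t.
  by apply: filterS At => t At; rewrite linearN /= At.
near=> t.
have i1 : (ind L <= ind (A t))%N.
  by near: t; exact: ind_lower_semicontinuous.
have i2 : (ind (- L) <= ind (- A t))%N.
  by near: t; exact: (ind_lower_semicontinuous (mx_cvgN AL)).
have rt : \rank (A t) = \rank L by near: t.
have st : (A t)^T = A t by near: t.
by have := ind_addN st; have := ind_addN Lt; lia.
Unshelve. all: by end_near. Qed.

End MatrixLimits.

(** * Index and image along the Loewner order *)

Section LoewnerOrder.
Variables (R : realType) (n : nat).
Implicit Types A B : 'M[R]_n.

Definition loewner_le A B : Prop := forall x, qform A x <= qform B x.

Lemma ind_loewner_le A B : A^T = A -> B^T = B -> loewner_le A B ->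
  (ind B <= ind A)%N.
Proof.
move=> /ind_nonneg_kernel [C pos] Bt AB; apply: (ind_le (C := C)) => // x xC.
exact: le_trans (pos _ xC) (AB x).
Qed.

Lemma loewner_leN A B : loewner_le A B -> loewner_le (- B) (- A).
Proof. by move=> AB x; rewrite !qformN lerN2. Qed.

Lemma qform_addl A (x y : 'rV[R]_n) : A^T = A ->
  qform A (x + y) = qform A x + 2 * (x *m A *m y^T) 0 0 + qform A y.
Proof.
move=> At; have e : (y *m A *m x^T) 0 0 = (x *m A *m y^T) 0 0.
  have <- : (y *m A *m x^T)^T = x *m A *m y^T.
    by rewrite !trmx_mul trmxK At mulmxA.
  by rewrite [RHS]mxE.
rewrite /qform linearD /= !mulmxDl !mulmxDr !mxE.
by move: e; rewrite !mxE => ->; ring.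
Qed.

Lemma qformZ A c (x : 'rV[R]_n) : qform A (c *: x) = c ^+ 2 * qform A x.
Proof. by rewrite /qform linearZ /= -!scalemxAl -scalemxAr !mxE mulrA expr2. Qed.

(** If z = x A were nonzero, the form at c x + z would be affine in c with nonzero slope; the chosen
    [c] gives it the value -1. *)
Lemma psd_qform0 A x : A^T = A -> (forall y, 0 <= qform A y) ->
  qform A x = 0 -> x *m A = 0.
Proof.
move=> At pos x0; apply/eqP; apply: contraT => z0.
set z := x *m A in z0; have := row_norm_gt0 z0.
set b := (z *m z^T) 0 0 => b0; pose c := - ((qform A z + 1) / (2 * b)).
have := pos (c *: x + z); rewrite qform_addl //.
rewrite qformZ x0 mulr0 add0r.
rewrite -!scalemxAl -/z [X in 2 * X]mxE -/b.
suff -> : 2 * (c * b) = - (qform A z + 1) by lra.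
by rewrite /c; field; rewrite gt_eqF.
Qed.

(* A vector [x] of the kernel of [A] with [x B x^T > 0] would enlarge a maximal
   subspace on which [A], hence also [B], is positive definite. *)
Lemma loewner_le_image A B : A^T = A -> B^T = B -> loewner_le A B ->
  ind (- A) = ind (- B) -> exists D, B = A *m D.
Proof.
move=> At Bt AB iAB.
have NAt : (- A)^T = - A by rewrite linearN /= At.
have NBt : (- B)^T = - B by rewrite linearN /= Bt.
have ABt : (B - A)^T = B - A by rewrite linearB /= At Bt.
have psd y : 0 <= qform (B - A) y by rewrite qformD qformN subr_ge0.
(* Inclusion of left kernels suffices: it is applied to the rows of [1%:M - A *m mpinvmx A]. *)
suff ker m (x : 'M[R]_(m, n)) : x *m A = 0 -> x *m B = 0.
  have [AKA _ _ _] := mpinvmxP A; exists (mpinvmx A *m B); rewrite mulmxA.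
  apply/eqP; rewrite -subr_eq0; apply/eqP.
  rewrite -[X in X - _]mul1mx -mulmxBl; apply: ker.
  by rewrite mulmxBl mul1mx AKA subrr.
move=> xA; apply/row_matrixP => i; rewrite row_mul row0.
have {xA} : row i x *m A = 0 by rewrite -row_mul xA row0.
move: (row i x) => {}x xA.
suff xB : qform B x <= 0.
  have x0 : qform (B - A) x = 0.
    apply/eqP; rewrite eq_le psd andbT qformD qformN {2}/qform xA mul0mx mxE.
    by rewrite subr0.
  have := psd_qform0 ABt psd x0; rewrite mulmxBr xA subr0; exact.
rewrite leNgt; apply/negP => xB.
have [C eC] := ind_negative_rows NAt.
have : (ind (- A) + 1 <= ind (- B))%N; last by rewrite iAB addn1 ltnn.
apply: (ind_ge (B := col_mx C x)) => // y y0.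
rewrite -[y]hsubmxK mul_row_col; set c := lsubmx y; set d := rsubmx y.
rewrite qformN oppr_lt0.
(* If [c] vanishes, positivity comes from [x] and [B]. Otherwise it comes from the frame and [A],
   where the contribution of [x] drops out because [x *m A = 0]. *)
have [c0|c0] := eqVneq c 0.
  have d0 : d 0 0 != 0.
    apply: contra y0 => /eqP d0; rewrite -[y]hsubmxK -/c -/d c0.
    by rewrite [d]mx11_scalar d0 raddf0 row_mx0.
  rewrite c0 mul0mx add0r [d]mx11_scalar mul_scalar_mx qformZ.
  by rewrite mulr_gt0 // exprn_even_gt0.
apply: lt_le_trans (AB _).
have dxA : d *m x *m A = 0 by rewrite -mulmxA xA mulmx0.
have z : (0 : 'M[R]_1) 0 0 = 0 by rewrite mxE.
rewrite addrC qform_addl // [qform A (d *m x)]/qform dxA !mul0mx z mulr0 !add0r.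
rewrite /qform.
have -> : (c *m C *m A *m (c *m C)^T) 0 0 = (c *m c^T) 0 0.
  rewrite trmx_mul !mulmxA -[c *m C *m A]mulmxA -[c *m (C *m A) *m _]mulmxA.
  have -> : C *m A *m C^T = 1%:M by apply: oppr_inj; rewrite -eC mulmxN mulNmx.
  by rewrite mulmx1.
exact: row_norm_gt0.
Qed.

End LoewnerOrder.

(** * Monotone symmetric paths on one side of a point *)

Section OneSidedLimits.
Variables (R : realType) (n : nat).
Implicit Types (A : R -> 'M[R]_n) (t : R).

Lemma near_left_itv t (P : R -> Prop) : (\forall u \near t^'-, P u) ->
  exists2 p, p < t & forall u, p < u < t -> P u.
Proof.
rewrite /at_left near_withinE => /nbhs_ballP [e /= e0 eP].
exists (t - e); first by rewrite ltrBlDr ltrDl.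
move=> u /andP[pu ut]; apply: eP => //=.
by rewrite /ball /= ger0_norm ?subr_ge0 ?ltW //; lra.
Qed.

Lemma near_right_itv t (P : R -> Prop) : (\forall u \near t^'+, P u) ->
  exists2 r, t < r & forall u, t < u < r -> P u.
Proof.
rewrite /at_right near_withinE => /nbhs_ballP [e /= e0 eP].
exists (t + e); first by rewrite ltrDl.
move=> u /andP[tu ur]; apply: eP => //=.
by rewrite /ball /= ler0_norm ?subr_le0 ?ltW //; lra.
Qed.

Lemma itv_near_left p t (P : R -> Prop) : p < t ->
  (forall u, p < u < t -> P u) -> \forall u \near t^'-, P u.
Proof.
move=> pt pP; have := nbhs_left_lt t; have := nbhs_left_gt pt.
by apply: filterS2 => u pu ut; apply: pP; rewrite pu ut.
Qed.

Lemma itv_near_right t r (P : R -> Prop) : t < r ->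
  (forall u, t < u < r -> P u) -> \forall u \near t^'+, P u.
Proof.
move=> tr pP; have := nbhs_right_gt t; have := nbhs_right_lt tr.
by apply: filterS2 => u ur tu; apply: pP; rewrite ur tu.
Qed.

(** The index of [- A] is nondecreasing and lower semicontinuous, hence has no jump at [t] from the
    left. The index of [A] is nonincreasing in the naturals, hence constant from a minimizer on.
    With both frozen, [loewner_le_image] applies to the pair and to its opposite. *)
Lemma monotone_near_left A p t : p < t ->
  (forall u, p < u <= t -> (A u)^T = A u) ->
  (forall u v, p < u -> u <= v -> v < t -> loewner_le (A u) (A v)) ->
  mx_cvg t^'- A (A t) ->
  \forall x \near t^'-,
    [/\ ind (- A x) = ind (- A t), (ind (A t) <= ind (A x))%N &
        forall y, x <= y < t ->
          (exists D, A y = A x *m D) /\ (exists D, A x = A y *m D)].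
Proof.
move=> pt At Amono Acvg.
have At_t : (A t)^T = A t by apply: At; rewrite pt lexx.
have AtN u : p < u <= t -> (- A u)^T = - A u by move=> /At h; rewrite linearN /= h.
(* The order is closed, so monotonicity passes to the limit at [t]. *)
have Amono_t u : p < u < t -> loewner_le (A u) (A t).
  move=> /andP[pu ut] x.
  apply: (cvgr_to_ge (mx_cvg_qform (x := x) Acvg)).
  apply: (itv_near_left ut) => v /andP[uv vt]; apply: Amono => //.
  exact: ltW.
have [m [x0 [px0 x0t ix0 minx0]]] : exists m x0, [/\ p < x0, x0 < t, ind (A x0) = m &
    forall u, p < u < t -> (m <= ind (A u))%N].
  have ex : exists m, `[< exists2 u, p < u < t & ind (A u) = m >].
    by exists (ind (A ((p + t) / 2))); apply/asboolP; exists ((p + t) / 2); rewrite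
      ?midf_lt.
  case: (ex_minnP ex) => m /asboolP [x0 /andP[px0 x0t] ix0] mmin.
  exists m, x0; split=> // u put; apply: mmin; apply/asboolP; by exists u.
have iconst u : x0 <= u < t -> ind (A u) = m.
  move=> /andP[x0u ut]; have pu := lt_le_trans px0 x0u.
  apply/eqP; rewrite eqn_leq minx0 ?pu // andbT -ix0.
  by apply: ind_loewner_le; [by apply: At; rewrite px0 ltW|by apply: At; rewrite pu
    ltW|apply: Amono].
have NAcvg : mx_cvg t^'- (fun u => - A u) (- A t) by exact: mx_cvgN.
have semi : \forall x \near t^'-, (ind (- A t) <= ind (- A x))%N.
  have tt : p < t <= t by rewrite pt lexx.
  have sym : \forall u \near t^'-, (- A u)^T = - A u.
    by apply: (itv_near_left pt) => u /andP[pu ut]; apply: AtN; rewrite pu ltW.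
  exact: (ind_lower_semicontinuous NAcvg (AtN _ tt) sym).
have [p' p't semi'] := near_left_itv semi.
apply: (itv_near_left (p := Order.max x0 p')); first by rewrite gt_max x0t.
move=> x /andP[]; rewrite gt_max => /andP[x0x p'x] xt.
have px := lt_trans px0 x0x.
have neg u : x <= u < t -> ind (- A u) = ind (- A t).
  move=> /andP[xu ut]; have pu := lt_le_trans px xu.
  apply/eqP; rewrite eqn_leq semi' ?(lt_le_trans p'x xu) // andbT.
  apply: ind_loewner_le; [by apply: AtN; rewrite pt lexx|by apply: AtN; rewrite pu
    ltW|].
  by apply: loewner_leN; apply: Amono_t; rewrite pu.
split; first by apply: neg; rewrite lexx.
  apply: ind_loewner_le; [by apply: At; rewrite px ltW|by []|].
  by apply: Amono_t; rewrite px.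
move=> y /andP[xy yt]; have py := lt_le_trans px xy.
have Ax : (A x)^T = A x by apply: At; rewrite px ltW.
have Ay : (A y)^T = A y by apply: At; rewrite py ltW.
have xyA : loewner_le (A x) (A y) by apply: Amono.
split; first by apply: loewner_le_image => //; rewrite !neg ?xy ?lexx.
have [||||D eD] := @loewner_le_image _ _ (- A y) (- A x).
- by rewrite linearN /= Ay.
- by rewrite linearN /= Ax.
- exact: loewner_leN.
- by rewrite !opprK !iconst ?yt ?(ltW x0x) ?(le_trans (ltW x0x) xy).
exists D; apply: oppr_inj; by rewrite eD mulNmx.
Qed.

Lemma near_opp_right t (P : R -> Prop) :
  (\forall x \near (- t)^'-, P x) -> \forall x \near t^'+, P (- x).
Proof. by rewrite at_leftN. Qed.

(** The path u |-> - A (- u) is again nondecreasing, and the passage to it swaps the two indices and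
    the two sides. *)
Lemma monotone_near_right A t r : t < r ->
  (forall u, t <= u < r -> (A u)^T = A u) ->
  (forall u v, t < u -> u <= v -> v < r -> loewner_le (A u) (A v)) ->
  mx_cvg t^'+ A (A t) ->
  \forall x \near t^'+,
    [/\ ind (A x) = ind (A t), (ind (- A t) <= ind (- A x))%N &
        forall y, t < y <= x ->
          (exists D, A y = A x *m D) /\ (exists D, A x = A y *m D)].
Proof.
move=> tr At Amono Acvg; pose B u := - A (- u).
have : \forall x \near (- t)^'-,
    [/\ ind (- B x) = ind (- B (- t)), (ind (B (- t)) <= ind (B x))%N &
        forall y, x <= y < - t ->
          (exists D, B y = B x *m D) /\ (exists D, B x = B y *m D)].
  apply: (@monotone_near_left B (- r)).
  - by rewrite ltrN2.
  - move=> u /andP[ru ut]; rewrite /B linearN /= At //.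
    by rewrite lerNr ut ltrNl.
  - move=> u v ru uv vt; apply: loewner_leN; apply: Amono.
    + by rewrite ltrNr.
    + by rewrite lerN2.
    + by rewrite ltrNl.
  - move=> i j; rewrite at_leftN /B.
    have NA : mx_cvg t^'+ (fun u => - A u) (- A t) by exact: mx_cvgN.
    have := NA i j; rewrite opprK => h; apply: cvg_trans h.
    by move=> S /=; rewrite /nbhs /= => h; apply: filterS h => u /=; rewrite opprK.
move=> /near_opp_right; apply: filterS => x; rewrite /B !opprK => -[i1 i2 im].
split=> // y /andP[ty yx].
have [|[D eD] [D' eD']] := im (- y); first by rewrite lerN2 yx ltrN2.
rewrite opprK in eD eD'; split; [exists D|exists D']; apply: oppr_inj.
  by rewrite eD mulNmx.
by rewrite eD' mulNmx.
Qed.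

End OneSidedLimits.

(** * Paths *)

Section Paths.
Variables (R : realType) (n : nat).
Implicit Types (Y Z : R -> 'M[R]_(n + n, n)) (a b t : R).

Lemma within_cvg_left m p (f : R -> 'M[R]_(m, p)) a b t :
  {within `[a, b], continuous f} -> a < t <= b -> mx_cvg t^'- f (f t).
Proof.
move=> cf /andP[at_ tb]; apply: cvg_mx_cvg.
have [fi _ fb] := (continuous_within_itvP f (lt_le_trans at_ tb)).1 cf.
move: tb; rewrite le_eqVlt => /orP[/eqP -> //|tb].
by apply: cvg_at_left_filter; apply: fi; rewrite in_itv /= at_.
Qed.

Lemma within_cvg_right m p (f : R -> 'M[R]_(m, p)) a b t :
  {within `[a, b], continuous f} -> a <= t < b -> mx_cvg t^'+ f (f t).
Proof.
move=> cf /andP[at_ tb]; apply: cvg_mx_cvg.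
have [fi fa _] := (continuous_within_itvP f (le_lt_trans at_ tb)).1 cf.
move: at_; rewrite le_eqVlt => /orP[/eqP <- //|at_].
by apply: cvg_at_right_filter; apply: fi; rewrite in_itv /= at_.
Qed.

Lemma knot_size a b s : itv_partition a b s -> knot a b s (size s) = b.
Proof. by move=> [_ /eqP]; rewrite /knot -[size s]/(size (a :: s)).-1 nth_last. Qed.

Lemma knot_lt a b s k : itv_partition a b s -> (k < size s)%N ->
  knot a b s k < knot a b s k.+1.
Proof. by move=> [/(pathP b) ps _] ks; exact: ps. Qed.

Lemma knot_ge a b s k : itv_partition a b s -> (k <= size s)%N ->
  a <= knot a b s k.
Proof.
move=> ps; elim: k => [|k IH] ks; first by rewrite /knot.
exact: le_trans (IH (ltnW ks)) (ltW (knot_lt ps ks)).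
Qed.

Lemma knot_le a b s k : itv_partition a b s -> (k <= size s)%N ->
  knot a b s k <= b.
Proof.
move=> ps ks; have : forall d, (k + d <= size s)%N -> knot a b s k <= knot a b s (k
  + d).
  elim=> [|d IH] kd; first by rewrite addn0.
  rewrite addnS in kd *; exact: le_trans (IH (ltnW kd)) (ltW (knot_lt ps kd)).
by move=> /(_ (size s - k)%N); rewrite subnKC // (knot_size ps); exact.
Qed.

Lemma knot_left a b s t : itv_partition a b s -> a < t <= b ->
  exists2 k, (k < size s)%N & knot a b s k < t <= knot a b s k.+1.
Proof.
move=> ps /andP[at_ tb].
have ex : exists k, (k <= size s)%N && (t <= knot a b s k).
  by exists (size s); rewrite leqnn (knot_size ps).
case: (ex_minnP ex) => -[|k] /andP[ks tk] kmin.
  by move: at_; rewrite ltNge {1}/knot /= in tk *; rewrite tk.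
exists k => //; rewrite tk andbT ltNge; apply/negP => tk'.
by have := kmin k; rewrite (ltnW ks) tk' ltnn; move=> /(_ isT).
Qed.

Lemma knot_right a b s t : itv_partition a b s -> a <= t < b ->
  exists2 k, (k < size s)%N & knot a b s k <= t < knot a b s k.+1.
Proof.
move=> ps /andP[at_ tb].
have ex : exists k, (k <= size s)%N && (t < knot a b s k).
  by exists (size s); rewrite leqnn (knot_size ps).
case: (ex_minnP ex) => -[|k] /andP[ks tk] kmin.
  by move: at_; rewrite leNgt {1}/knot /= in tk *; rewrite tk.
exists k => //; rewrite tk andbT leNgt; apply/negP => tk'.
by have := kmin k; rewrite (ltnW ks) tk' ltnn; move=> /(_ isT).
Qed.

Lemma piecewise_derivable_left Y a b t : piecewise_C1 Y a b -> a < t <= b ->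
  exists p, [/\ a <= p, p < t & forall u, p < u < t -> derivable Y u 1].
Proof.
move=> [_ [s ps dY]] tab; have [k ks /andP[kt tk]] := knot_left ps tab.
exists (knot a b s k); split=> //; first exact: knot_ge ps (ltnW ks).
move=> u /andP[ku ut]; have [dYk _ _ _] := dY k ks.
by apply: dYk; rewrite in_itv /= ku (lt_le_trans ut).
Qed.

Lemma piecewise_derivable_right Y a b t : piecewise_C1 Y a b -> a <= t < b ->
  exists r, [/\ r <= b, t < r & forall u, t < u < r -> derivable Y u 1].
Proof.
move=> [_ [s ps dY]] tab; have [k ks /andP[kt tk]] := knot_right ps tab.
exists (knot a b s k.+1); split=> //; first exact: knot_le ps ks.
move=> u /andP[ku ut]; have [dYk _ _ _] := dY k ks.
by apply: dYk; rewrite in_itv /= ut (le_lt_trans kt).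
Qed.

Lemma derivable_quotient (V : normedModType R) (f : R -> V) t :
  derivable f t 1 -> h^-1 *: (f (h + t) - f t) @[h --> 0^'] --> 'D_1 f t.
Proof.
rewrite /derivable /derive.
by under eq_fun do rewrite /= /GRing.scale /= mulr1.
Qed.

Lemma quotient_derivable (V : normedModType R) (f : R -> V) t l :
  h^-1 *: (f (h + t) - f t) @[h --> 0^'] --> l ->
  derivable f t 1 /\ 'D_1 f t = l.
Proof.
move=> fl; suff fl' : h^-1 *: ((f \o shift t) (h *: 1) - f t) @[h --> 0^'] --> l.
  by split; [apply/cvg_ex; exists l|exact: cvg_lim fl'].
by under eq_fun do rewrite /= /GRing.scale /= mulr1.
Qed.

Lemma right_derivative_derivable Y t :
  derivable Y t 1 -> right_derivative Y t = 'D_1 Y t.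
Proof.
move=> /derivable_quotient dY; apply: cvg_lim => //.
by under eq_fun do rewrite [t + _]addrC; exact: cvg_dnbhs_at_right.
Qed.

(** For a fixed vector the form of the chart has as derivative the form of Y'^T J Y at a transformed
    vector. Working with quotients requires only continuity of the inverse, not its derivative. *)
Lemma chart_nondecreasing Y q p r :
  (forall u, p < u < r -> lagrangian (Y u)) ->
  (forall u, p < u < r -> chart_den q (Y u) \in unitmx) ->
  (forall u, p < u < r -> derivable Y u 1) ->
  (forall u, p < u < r -> psdmx ((right_derivative Y u)^T *m Jmx R n *m Y u)) ->
  forall u v, p < u -> u <= v -> v < r ->
    loewner_le (chart q (Y u)) (chart q (Y v)).
Proof.
move=> lY uY dY pY u v pu uv vr x; pose f w := qform (chart q (Y w)) x.
have quot w : p < w < r -> exists2 l : R, 0 <= l &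
    h^-1 *: (f (h + w) - f w) @[h --> 0^'] --> l.
  move=> pwr; pose D := 'D_1 Y w.
  pose G h := h^-1 *: (Y (h + w) - Y w).
  have GD : mx_cvg 0^' G D by apply: cvg_mx_cvg; exact: derivable_quotient (dY _ pwr).
  have h0 : h @[h --> 0^'] --> (0 : R) by apply: cvg_within_filter; exact: cvg_id.
  have near_ne : \forall h \near 0^', h != 0 :> R by exact: nbhs_dnbhs_neq.
  have YD : mx_cvg 0^' (fun h => Y (h + w)) (Y w).
    move=> i j; have -> : Y w i j = 0 * D i j + Y w i j by rewrite mul0r add0r.
    apply: cvg_trans; last first.
      by apply: (cvgD (cvgM h0 (GD i j))); exact: (cvg_cst (Y w i j)).
    apply: (near_eq_cvg (f := fun h => h * G h i j + Y w i j)).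
    apply: filterS near_ne => h hn.
    by rewrite /G /= !mxE mulVKf // subrK.
  have near_itv : \forall h \near 0^', p < h + w < r.
    have e0 : 0 < Order.min (w - p) (r - w) by rewrite lt_min !subr_gt0.
    apply: filterS (cvgr_dist_lt _ _ h0 _ e0) => h.
    rewrite sub0r normrN lt_min => /andP[].
    by rewrite !ltr_norml; lra.
  pose B h := (invmx (chart_den q (Y h)))^T.
  exists (qform (B w *m (D^T *m Jmx R n *m Y w) *m (B w)^T) x).
    rewrite qformM; have [_ ] := pY _ pwr.
    rewrite right_derivative_derivable; last exact: dY.
    by move=> /(_ (x *m B w)^T); rewrite trmxK.
  have BD : mx_cvg 0^' (fun h => B (h + w)) (B w).
    apply: mx_cvg_tr; apply: mx_cvg_inv; last exact: uY.
    exact: mx_cvg_chart_den YD.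
  have CD : mx_cvg 0^' (fun h => (G h)^T *m Jmx R n *m Y w) (D^T *m Jmx R n *m Y w).
    by apply: mx_cvgM; [apply: mx_cvgM; [exact: mx_cvg_tr|]|]; apply: mx_cvg_cst.
  have ED : mx_cvg 0^'
      (fun h => B (h + w) *m ((G h)^T *m Jmx R n *m Y w) *m (B w)^T)
      (B w *m (D^T *m Jmx R n *m Y w) *m (B w)^T).
    by apply: mx_cvgM; [exact: mx_cvgM|apply: mx_cvg_cst].
  apply: cvg_trans; last exact: mx_cvg_qform ED.
  apply: near_eq_cvg; near=> h.
  have hn : h != 0 by near: h.
  have ph : p < h + w < r by near: h.
  rewrite /f -qformN -qformD chart_sub ?uY //; last exact: lY.
  (* Isotropy of [Y w] removes the zeroth-order term, so the Wronskian is exactly of the order of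
     [h]. *)
  have -> : wronskian (Y (h + w)) (Y w) = h *: ((G h)^T *m Jmx R n *m Y w).
    rewrite /G linearZ /= -!scalemxAl scalerA mulfV // scale1r linearB /= !mulmxBl.
    by have [e _] := lY _ pwr; rewrite /wronskian e subr0.
  rewrite -scalemxAr -scalemxAl /B trmxK.
  by rewrite /qform -scalemxAr -scalemxAl !mxE /GRing.scale /= mulKf.
have itv w : w \in `]p, r[ -> p < w < r by rewrite in_itv.
have fd w : w \in `]p, r[ -> derivable f w 1.
  by move=> /itv /quot [l _ /quotient_derivable[]].
have fd0 w : w \in `]p, r[ -> 0 <= f^`()%classic w.
  by move=> /itv /quot [l l0 /quotient_derivable[_]]; rewrite derive1E => ->.
(* The two booleans select the open interval. *)
apply: (@ger0_derive1_le R f p r fd fd0 false true) => //.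
- exact: derivable_within_continuous.
- by rewrite in_itv /= pu (le_lt_trans uv).
by rewrite in_itv /= vr (lt_le_trans pu).
Unshelve. all: by end_near.
Qed.

End Paths.

(** * Images, ranks and comparative indices near a point *)

Section LocalBehaviour.
Variables (R : realType) (n : nat).
Implicit Types (Y Z : R -> 'M[R]_(n + n, n)) (a b t : R).

Lemma im_mxM m k l (A : 'M[R]_(m, k)) (B : 'M[R]_(k, l)) :
  im_mx (A *m B) `<=` im_mx A.
Proof. by move=> _ [v _ <-]; exists (B *m v) => //; rewrite mulmxA. Qed.

Lemma im_chart q (Y : 'M[R]_(n + n, n)) : chart_den q Y \in unitmx ->
  im_mx (chart q Y) = im_mx (usubmx Y).
Proof.
move=> uY; apply/seteqP; split; first exact: im_mxM.
by rewrite {1}(usubmx_chart uY); exact: im_mxM.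
Qed.

(** One-sided neighbourhoods are shrunk until the chart is defined and no break point remains
    inside. The range of [y] stops short of [t], where the image may drop. *)
Lemma chart_near_left Y a b t q : lagrangian_path Y a b -> piecewise_C1 Y a b ->
  monotone_path Y a b -> a < t <= b -> chart_den q (Y t) \in unitmx ->
  \forall x \near t^'-, [/\ a < x, chart_den q (Y x) \in unitmx,
    ind (- chart q (Y x)) = ind (- chart q (Y t)),
    (ind (chart q (Y t)) <= ind (chart q (Y x)))%N &
    forall y, x <= y < t -> im_mx (usubmx (Y y)) = im_mx (usubmx (Y x))].
Proof.
move=> [cY lY] dY [mY _] atb uYt; have Yt := within_cvg_left cY atb.
have lYab u : a <= u <= b -> lagrangian (Y u) by move=> ab; apply: lY; rewrite in_itv.
have [at_ tb] := andP atb.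
have [p1 p1t up1] := near_left_itv (mx_cvg_unitmx (mx_cvg_chart_den Yt) uYt).
have [p2 [ap2 p2t dp2]] := piecewise_derivable_left dY atb.
pose p := Order.max p1 p2; have pt : p < t by rewrite gt_max p1t.
have pP u : p < u < t -> [/\ p1 < u < t, p2 < u < t & a < u].
  rewrite gt_max => /andP[/andP[p1u p2u] ut]; split; rewrite ?p1u ?p2u //.
  exact: le_lt_trans p2u.
have unit_p u : p < u < t -> chart_den q (Y u) \in unitmx.
  by move=> /pP[p1u _ _]; exact: up1.
have unit_pt u : p < u <= t -> chart_den q (Y u) \in unitmx.
  move=> /andP[pu]; rewrite le_eqVlt => /orP[/eqP -> //|ut].
  by apply: unit_p; rewrite pu.
have lag_pt u : p < u <= t -> lagrangian (Y u).
  move=> /andP[pu ut]; apply: lYab; rewrite (le_trans ut) // andbT.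
  move: pu; rewrite gt_max => /andP[_ p2u]; exact: le_trans ap2 (ltW p2u).
have lag_p u : p < u < t -> lagrangian (Y u).
  by move=> /andP[pu ut]; apply: lag_pt; rewrite pu ltW.
have mono u v : p < u -> u <= v -> v < t ->
    loewner_le (chart q (Y u)) (chart q (Y v)).
  apply: chart_nondecreasing => // w pwt; first by apply: dp2; case: (pP _ pwt).
  have [_ /andP[_ wt] aw] := pP _ pwt.
  by apply: mY; rewrite in_itv /= (ltW aw) (lt_le_trans wt).
have sym u : p < u <= t -> (chart q (Y u))^T = chart q (Y u).
  by move=> put; apply: chart_sym; [exact: lag_pt|exact: unit_pt].
have At : mx_cvg t^'- (fun u => chart q (Y u)) (chart q (Y t)).
  exact: mx_cvg_chart.
have [p' p't p'P] := near_left_itv (monotone_near_left pt sym mono At).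
apply: (itv_near_left (p := Order.max p p')); first by rewrite gt_max pt.
move=> x /andP[]; rewrite gt_max => /andP[px p'x] xt.
have pxt : p < x < t by rewrite px.
have [|i1 i2 im] := p'P x; first by rewrite p'x.
split; [by case: (pP _ pxt)|exact: unit_p|exact: i1|exact: i2|].
move=> y /andP[xy yt]; have pyt : p < y < t by rewrite (lt_le_trans px).
have [|[D eD] [D' eD']] := im y; first by rewrite xy.
rewrite -(im_chart (unit_p _ pyt)) -(im_chart (unit_p _ pxt)).
by apply/seteqP; split; [rewrite eD|rewrite eD']; exact: im_mxM.
Qed.

Lemma chart_near_right Y a b t q : lagrangian_path Y a b -> piecewise_C1 Y a b ->
  monotone_path Y a b -> a <= t < b -> chart_den q (Y t) \in unitmx ->
  \forall x \near t^'+, [/\ x < b, chart_den q (Y x) \in unitmx,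
    ind (chart q (Y x)) = ind (chart q (Y t)),
    (ind (- chart q (Y t)) <= ind (- chart q (Y x)))%N &
    forall y, t < y <= x -> im_mx (usubmx (Y y)) = im_mx (usubmx (Y x))].
Proof.
move=> [cY lY] dY [mY _] atb uYt; have Yt := within_cvg_right cY atb.
have lYab u : a <= u <= b -> lagrangian (Y u) by move=> ab; apply: lY; rewrite in_itv.
have [at_ tb] := andP atb.
have [r1 r1t ur1] := near_right_itv (mx_cvg_unitmx (mx_cvg_chart_den Yt) uYt).
have [r2 [r2b tr2 dr2]] := piecewise_derivable_right dY atb.
pose r := Order.min r1 r2; have tr : t < r by rewrite lt_min r1t.
have rP u : t < u < r -> [/\ t < u < r1, t < u < r2 & u < b].
  rewrite lt_min => /andP[tu /andP[ur1' ur2]]; split; rewrite ?tu ?ur1' //.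
  exact: lt_le_trans ur2 r2b.
have unit_r u : t < u < r -> chart_den q (Y u) \in unitmx.
  by move=> /rP[tu _ _]; exact: ur1.
have unit_tr u : t <= u < r -> chart_den q (Y u) \in unitmx.
  move=> /andP[]; rewrite le_eqVlt => /orP[/eqP <- //|tu] ur.
  by apply: unit_r; rewrite tu.
have lag_tr u : t <= u < r -> lagrangian (Y u).
  move=> /andP[tu]; rewrite lt_min => /andP[_ ur2]; apply: lYab.
  by rewrite (le_trans at_) //= (le_trans (ltW ur2)).
have lag_r u : t < u < r -> lagrangian (Y u).
  by move=> /andP[tu ur]; apply: lag_tr; rewrite (ltW tu).
have mono u v : t < u -> u <= v -> v < r ->
    loewner_le (chart q (Y u)) (chart q (Y v)).
  apply: chart_nondecreasing => // w twr; first by apply: dr2; case: (rP _ twr).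
  have [_ /andP[tw _] wb] := rP _ twr.
  by apply: mY; rewrite in_itv /= wb (le_trans at_ (ltW tw)).
have sym u : t <= u < r -> (chart q (Y u))^T = chart q (Y u).
  by move=> tur; apply: chart_sym; [exact: lag_tr|exact: unit_tr].
have At : mx_cvg t^'+ (fun u => chart q (Y u)) (chart q (Y t)).
  exact: mx_cvg_chart.
have [r' tr' r'P] := near_right_itv (monotone_near_right tr sym mono At).
apply: (itv_near_right (r := Order.min r r')); first by rewrite lt_min tr.
move=> x /andP[tx]; rewrite lt_min => /andP[xr xr'].
have txr : t < x < r by rewrite tx.
have [|i1 i2 im] := r'P x; first by rewrite tx.
split; [by case: (rP _ txr)|exact: unit_r|exact: i1|exact: i2|].
move=> y /andP[ty yx]; have tyr : t < y < r by rewrite ty (le_lt_trans yx).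
have [|[D eD] [D' eD']] := im y; first by rewrite ty.
rewrite -(im_chart (unit_r _ tyr)) -(im_chart (unit_r _ txr)).
by apply/seteqP; split; [rewrite eD|rewrite eD']; exact: im_mxM.
Qed.

Lemma rank_chart_ind q (Y : 'M[R]_(n + n, n)) : lagrangian Y ->
  chart_den q Y \in unitmx ->
  \rank (usubmx Y) = (ind (chart q Y) + ind (- chart q Y))%N.
Proof.
by move=> lY uY; rewrite -(rank_chart uY) (ind_addN (chart_sym lY uY)).
Qed.

Lemma lagrangian_path_in Y a b t : lagrangian_path Y a b -> a <= t <= b ->
  lagrangian (Y t).
Proof. by move=> [_ lY] ab; apply: lY; rewrite in_itv. Qed.

(* Since [Z] is transversal to the verticals and to [Y] to a constant degree, the
   indices of [chart q (Z x)] and of [chart q (Y x) - chart q (Z x)] do not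
   change with [x]. *)
Lemma cind_near_constant (T : Type) (F : set_system T) {FF : ProperFilter F}
    (Y Z : T -> 'M[R]_(n + n, n)) (Yt Zt : 'M[R]_(n + n, n)) q :
  mx_cvg F Y Yt -> mx_cvg F Z Zt -> lagrangian Yt -> lagrangian Zt ->
  chart_den q Yt \in unitmx -> chart_den q Zt \in unitmx ->
  (\forall x \near F, [/\ lagrangian (Y x), lagrangian (Z x),
     \rank (wronskian (Z x) (Y x)) = \rank (wronskian Zt Yt) &
     \rank (usubmx (Z x)) = \rank (usubmx Zt)]) ->
  \forall x \near F,
    (cind (Y x) (Z x) + ind (chart q (Y x)) =
       cind Yt Zt + ind (chart q Yt))%N /\
    (dual_cind (Y x) (Z x) + ind (- chart q (Y x)) =
       dual_cind Yt Zt + ind (- chart q Yt))%N.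
Proof.
move=> cY cZ lYt lZt uYt uZt nearx.
have uY : \forall x \near F, chart_den q (Y x) \in unitmx.
  exact: mx_cvg_unitmx (mx_cvg_chart_den cY) uYt.
have uZ : \forall x \near F, chart_den q (Z x) \in unitmx.
  exact: mx_cvg_unitmx (mx_cvg_chart_den cZ) uZt.
have AZ : mx_cvg F (fun x => chart q (Z x)) (chart q Zt) by exact: mx_cvg_chart.
have AY : mx_cvg F (fun x => chart q (Y x)) (chart q Yt) by exact: mx_cvg_chart.
have AYZ : mx_cvg F (fun x => chart q (Y x) - chart q (Z x))
    (chart q Yt - chart q Zt) by exact: mx_cvgB.
have rw (V W : 'M[R]_(n + n, n)) : \rank (wronskian V W) = \rank (wronskian W V).
  by rewrite -(mxrank_tr (wronskian W V)) wronskian_tr eqmx_opp.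
have iZ := ind_near_constant_rank AZ (chart_sym lZt uZt).
have YZt : (chart q Yt - chart q Zt)^T = chart q Yt - chart q Zt.
  by rewrite linearB /= !chart_sym.
have iYZ := ind_near_constant_rank AYZ YZt.
have {}iZ : \forall x \near F, ind (chart q (Z x)) = ind (chart q Zt) /\
    ind (- chart q (Z x)) = ind (- chart q Zt).
  apply: iZ; first by apply: filterS2 uZ nearx => x uZx [_ lZx _ _]; exact: chart_sym.
  apply: filterS2 uZ nearx => x uZx [_ _ _ rZ].
  by rewrite !rank_chart.
have {}iYZ : \forall x \near F,
    ind (chart q (Y x) - chart q (Z x)) = ind (chart q Yt - chart q Zt) /\
    ind (- (chart q (Y x) - chart q (Z x))) =
      ind (- (chart q Yt - chart q Zt)).
  apply: iYZ; apply: filterS3 uY uZ nearx => x uYx uZx [lYx lZx rYZ _].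
    by rewrite linearB /= (chart_sym lYx uYx) (chart_sym lZx uZx).
  by rewrite -!rank_wronskian // rw rYZ rw.
apply: filterS3 (filterI uY uZ) (filterI iYZ iZ) nearx.
move=> x [uYx uZx] [[i1 i2] [j1 j2]] [lYx lZx _ _].
have [c1 c2] := cind_chart lYx lZx uYx uZx.
have [d1 d2] := cind_chart lYt lZt uYt uZt.
split; first exact: (etrans c1 (etrans (congr2 addn j1 i1) (esym d1))).
exact: (etrans c2 (etrans (congr2 addn j2 i2) (esym d2))).
Qed.

(** The sum of the comparative index and [ind (chart q (Y x))] is locally constant, and so is its
    dual. On the left only the negative index of the chart moves, so it alone accounts for the
    change of rank and the dual comparative index stays put. *)
Lemma cind_near_left Y Z a b t : lagrangian_path Y a b -> piecewise_C1 Y a b ->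
  monotone_path Y a b -> a < t <= b -> mx_cvg t^'- Z (Z t) -> lagrangian (Z t) ->
  (\forall x \near t^'-, [/\ lagrangian (Z x),
     \rank (wronskian (Z x) (Y x)) = \rank (wronskian (Z t) (Y t)) &
     \rank (usubmx (Z x)) = \rank (usubmx (Z t))]) ->
  \forall x \near t^'-,
    (cind (Y t) (Z t) + \rank (usubmx (Y t)) =
       cind (Y x) (Z x) + \rank (usubmx (Y x)))%N /\
    dual_cind (Y x) (Z x) = dual_cind (Y t) (Z t).
Proof.
move=> lY dY mY atb cZ lZt nearZ; have [at_ tb] := andP atb.
have lYt : lagrangian (Y t) by apply: (lagrangian_path_in lY); rewrite ltW.
have [q [uYt uZt]] := common_chart lYt lZt.
have cY : mx_cvg t^'- Y (Y t) by exact: within_cvg_left lY.1 atb.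
have lYx : \forall x \near t^'-, lagrangian (Y x).
  apply: (itv_near_left at_) => x /andP[ax xt]; apply: (lagrangian_path_in lY).
  by rewrite (ltW ax) (le_trans (ltW xt)).
have nearYZ : \forall x \near t^'-, [/\ lagrangian (Y x), lagrangian (Z x),
     \rank (wronskian (Z x) (Y x)) = \rank (wronskian (Z t) (Y t)) &
     \rank (usubmx (Z x)) = \rank (usubmx (Z t))].
  by apply: filterS2 lYx nearZ => x lYx [].
apply: filterS3 lYx (cind_near_constant cY cZ lYt lZt uYt uZt nearYZ)
  (chart_near_left lY dY mY atb uYt) => x {}lYx [c1 c2] [_ uYx i1 _ _].
have rt := rank_chart_ind lYt uYt; have rx := rank_chart_ind lYx uYx.
move: (cind _ _) (cind _ _) (dual_cind _ _) (dual_cind _ _) c1 c2.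
move: (ind _) (ind _) (ind _) (ind _) (\rank _) (\rank _) i1 rt rx.
by move=> *; lia.
Qed.

(** On the right the positive index of the chart moves instead, so the change of rank falls on the
    dual comparative index. *)
Lemma cind_near_right Y Z a b t : lagrangian_path Y a b -> piecewise_C1 Y a b ->
  monotone_path Y a b -> a <= t < b -> mx_cvg t^'+ Z (Z t) -> lagrangian (Z t) ->
  (\forall x \near t^'+, [/\ lagrangian (Z x),
     \rank (wronskian (Z x) (Y x)) = \rank (wronskian (Z t) (Y t)) &
     \rank (usubmx (Z x)) = \rank (usubmx (Z t))]) ->
  \forall x \near t^'+,
    cind (Y x) (Z x) = cind (Y t) (Z t) /\
    (dual_cind (Y t) (Z t) + \rank (usubmx (Y t)) =
       dual_cind (Y x) (Z x) + \rank (usubmx (Y x)))%N.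
Proof.
move=> lY dY mY atb cZ lZt nearZ; have [at_ tb] := andP atb.
have lYt : lagrangian (Y t) by apply: (lagrangian_path_in lY); rewrite at_ ltW.
have [q [uYt uZt]] := common_chart lYt lZt.
have cY : mx_cvg t^'+ Y (Y t) by exact: within_cvg_right lY.1 atb.
have lYx : \forall x \near t^'+, lagrangian (Y x).
  apply: (itv_near_right tb) => x /andP[tx xb]; apply: (lagrangian_path_in lY).
  by rewrite (ltW xb) (le_trans at_ (ltW tx)).
have nearYZ : \forall x \near t^'+, [/\ lagrangian (Y x), lagrangian (Z x),
     \rank (wronskian (Z x) (Y x)) = \rank (wronskian (Z t) (Y t)) &
     \rank (usubmx (Z x)) = \rank (usubmx (Z t))].
  by apply: filterS2 lYx nearZ => x lYx [].
apply: filterS3 lYx (cind_near_constant cY cZ lYt lZt uYt uZt nearYZ)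
  (chart_near_right lY dY mY atb uYt) => x {}lYx [c1 c2] [_ uYx i1 _ _].
have rt := rank_chart_ind lYt uYt; have rx := rank_chart_ind lYx uYx.
move: (cind _ _) (cind _ _) (dual_cind _ _) (dual_cind _ _) c1 c2.
move: (ind _) (ind _) (ind _) (ind _) (\rank _) (\rank _) i1 rt rx.
by move=> *; lia.
Qed.

Lemma im_mx_rank_le m k l (A : 'M[R]_(m, k)) (B : 'M[R]_(m, l)) :
  im_mx A `<=` im_mx B -> (\rank A <= \rank B)%N.
Proof.
move=> AB; have /choice [D eD] : forall j, exists v, B *m v = col j A.
  by move=> j; have [|v _ <-] := AB (col j A); [exists (delta_mx j 0); rewrite //
    colE|exists v].
have -> : A = B *m (\matrix_(i, j) D j i 0).
  apply/matrixP => i j; have /colP/(_ i) := eD j; rewrite !mxE => <-.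
  by apply: eq_bigr => h _; rewrite mxE.
by rewrite mxrankM_maxl.
Qed.

Lemma im_mx_rank m k (A B : 'M[R]_(m, k)) : im_mx A = im_mx B -> \rank A = \rank B.
Proof.
by move=> AB; apply/eqP; rewrite eqn_leq !im_mx_rank_le // AB.
Qed.

Lemma rank_left_const Y x t r : x < t ->
  (forall u, x < u < t -> \rank (usubmx (Y u)) = r) -> rank_left Y t = r.
Proof.
move=> xt Yr; apply: lim_near_cst; first exact: order_hausdorff.
exact: itv_near_left xt Yr.
Qed.

Lemma rank_right_const Y t x r : t < x ->
  (forall u, t < u < x -> \rank (usubmx (Y u)) = r) -> rank_right Y t = r.
Proof.
move=> tx Yr; apply: lim_near_cst; first exact: order_hausdorff.
exact: itv_near_right tx Yr.
Qed.

Lemma image_near_left Y a b t : lagrangian_path Y a b -> piecewise_C1 Y a b ->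
  monotone_path Y a b -> a < t <= b ->
  \forall x \near t^'-, [/\ a < x, x < t,
    (\rank (usubmx (Y t)) <= \rank (usubmx (Y x)))%N &
    forall y, x <= y < t -> im_mx (usubmx (Y y)) = im_mx (usubmx (Y x))].
Proof.
move=> lY dY mY atb; have [at_ tb] := andP atb.
have lYt : lagrangian (Y t) by apply: (lagrangian_path_in lY); rewrite ltW.
have [q [uYt _]] := common_chart lYt lYt.
apply: filterS2 (nbhs_left_lt t) (chart_near_left lY dY mY atb uYt).
move=> x xt [ax uYx i1 i2 im]; split; [exact: ax|exact: xt| |exact: im].
rewrite (rank_chart_ind lYt uYt) (rank_chart_ind _ uYx); last first.
  by apply: (lagrangian_path_in lY); rewrite (ltW ax) (le_trans (ltW xt)).
by move: (ind _) (ind _) (ind _) (ind _) i1 i2 => *; lia.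
Qed.

Lemma image_near_right Y a b t : lagrangian_path Y a b -> piecewise_C1 Y a b ->
  monotone_path Y a b -> a <= t < b ->
  \forall x \near t^'+, [/\ x < b, t < x,
    (\rank (usubmx (Y t)) <= \rank (usubmx (Y x)))%N &
    forall y, t < y <= x -> im_mx (usubmx (Y y)) = im_mx (usubmx (Y x))].
Proof.
move=> lY dY mY atb; have [at_ tb] := andP atb.
have lYt : lagrangian (Y t) by apply: (lagrangian_path_in lY); rewrite at_ ltW.
have [q [uYt _]] := common_chart lYt lYt.
apply: filterS2 (nbhs_right_gt t) (chart_near_right lY dY mY atb uYt).
move=> x tx [xb uYx i1 i2 im]; split; [exact: xb|exact: tx| |exact: im].
rewrite (rank_chart_ind lYt uYt) (rank_chart_ind _ uYx); last first.
  by apply: (lagrangian_path_in lY); rewrite (ltW xb) (le_trans at_ (ltW tx)).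
by move: (ind _) (ind _) (ind _) (ind _) i1 i2 => *; lia.
Qed.

End LocalBehaviour.

(** * Passage from local to global *)

Section IntervalInduction.
Variable R : realType.

(** The left condition places the supremum of the points reached from [a] in the set, and the right
    condition would push past it before [b]. A relation between two endpoints, rather than a
    property of one, lets additive quantities enter through transitivity. *)
Lemma interval_induction (P : R -> R -> Prop) (a b : R) : a <= b ->
  (forall x, a <= x <= b -> P x x) ->
  (forall x y z, a <= x -> x <= y -> y <= z -> z <= b -> P x y -> P y z -> P x z) ->
  (forall t, a < t <= b -> \forall x \near t^'-, P x t) ->
  (forall t, a <= t < b -> \forall x \near t^'+, P t x) -> P a b.
Proof.
move=> ab refl trans left right.
pose S := [set x | a <= x <= b /\ P a x].
have Sa : S a by split; [rewrite lexx|apply: refl; rewrite lexx].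
have Sub : ubound S b by move=> x [/andP[]].
have hs : has_sup S by split; [exists a|exists b].
pose c := sup S; have ac : a <= c by apply: ub_le_sup => //; exists b.
have cb : c <= b by apply: ge_sup => //; exists a.
have Pac : P a c.
  move: ac; rewrite le_eqVlt => /orP[/eqP <-|ac]; first by case: Sa.
  have [|p pc pP] := near_left_itv (left c _); first by rewrite ac.
  have [x Sx px] := sup_gt (ex_intro _ a Sa) pc.
  have xc : x <= c by apply: ub_le_sup => //; exists b.
  have [/andP[ax xb] Pax] := Sx.
  move: xc; rewrite le_eqVlt => /orP[/eqP <- //|xc].
  by apply: (trans _ x) => //; [exact: ltW|apply: pP; rewrite px].
move: cb; rewrite le_eqVlt => /orP[/eqP <- //|cb].
have [|r cr rP] := near_right_itv (right c _); first by rewrite ac.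
have [d /andP[cd dr]] : exists d, c < d < Order.min b r.
  by exists ((c + Order.min b r) / 2); rewrite !midf_lt // lt_min cb cr.
move: dr; rewrite lt_min => /andP[db dr].
have : d <= c; last by rewrite leNgt cd.
apply: ub_le_sup; first by exists b.
split; first by rewrite (le_trans ac (ltW cd)) ltW.
by apply: (trans _ c) => //; [exact: ltW|exact: ltW|apply: rP; rewrite cd].
Qed.

(** The induction runs on chains of [G]-steps, which concatenate even when [G] is not transitive; a
    chain from [a] to [b] is the partition. *)
Lemma local_partition (G : R -> R -> Prop) (a b : R) : a <= b ->
  (forall t, a < t <= b -> \forall x \near t^'-, G x t) ->
  (forall t, a <= t < b -> \forall x \near t^'+, G t x) ->
  exists2 s, itv_partition a b s &
    forall k, (k < size s)%N -> G (knot a b s k) (knot a b s k.+1).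
Proof.
move=> ab left right; pose e x y := `[< x < y /\ G x y >].
have [s ps sb] : exists2 s, path e a s & last a s = b.
  pose P x y := exists2 s, path e x s & last x s = y.
  apply: (interval_induction (P := P)) => //.
  - by move=> x _; exists [::].
  - move=> x y z _ _ _ _ [s1 p1 l1] [s2 p2 l2]; exists (s1 ++ s2).
      by rewrite cat_path p1 l1.
    by rewrite last_cat l1.
  - move=> t /left; apply: filterS2 (nbhs_left_lt t) => x xt Gxt.
    by exists [:: t] => //=; rewrite andbT; apply/asboolP.
  - move=> t /right; apply: filterS2 (nbhs_right_gt t) => x tx Gtx.
    by exists [:: x] => //=; rewrite andbT; apply/asboolP.
exists s.
  split; last exact/eqP.
  by apply: sub_path ps => x y /asboolP[].
by move=> k ks; have /(pathP b)/(_ k ks)/asboolP[] := ps.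
Qed.

(** The index sets will be intervals, so additivity has to rest on finiteness of the supports. *)
Lemma fsum_disjoint (f : R -> int) (A B : set R) :
  finite_set (A `&` [set t | f t != 0]) -> finite_set (B `&` [set t | f t != 0]) ->
  A `&` B `<=` set0 ->
  \sum_(t \in A `|` B) f t = \sum_(t \in A) f t + \sum_(t \in B) f t.
Proof.
move=> fA fB AB.
have supp C : \sum_(t \in C) f t = \sum_(t \in C `&` [set t | f t != 0]) f t.
  rewrite fsbig_supp; apply: eq_fsbigl; congr (_ `&` _).
  by apply/seteqP; split=> t /= /eqP.
rewrite supp setIUl fsbigU0 //; first by rewrite -(supp A) -(supp B).
by move=> t [[At _] [Bt _]]; exact: (AB t).
Qed.

End IntervalInduction.

(** * Finiteness of the rank jumps *)

Section Jumps.
Variables (R : realType) (n : nat).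
Implicit Types (Y Z : R -> 'M[R]_(n + n, n)) (a b c d t : R).

Definition left_jump Y t : int :=
  (rank_left Y t)%:Z - (\rank (usubmx (Y t)))%:Z.

Definition right_jump Y t : int :=
  (rank_right Y t)%:Z - (\rank (usubmx (Y t)))%:Z.

(** The rank is constant on [x, t). This controls the right jump at [x] itself but not the left one,
    whence the different ranges of [y]. *)
Lemma jumps_near_left Y a b t : lagrangian_path Y a b -> piecewise_C1 Y a b ->
  monotone_path Y a b -> a < t <= b ->
  \forall x \near t^'-, [/\ a < x < t,
    left_jump Y t = (\rank (usubmx (Y x)))%:Z - (\rank (usubmx (Y t)))%:Z,
    0 <= left_jump Y t,
    forall y, x < y < t -> left_jump Y y = 0 &
    forall y, x <= y < t -> right_jump Y y = 0].
Proof.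
move=> lY dY mY atb; apply: filterS (image_near_left lY dY mY atb).
move=> x [ax xt rx im].
have rk y : x <= y < t -> \rank (usubmx (Y y)) = \rank (usubmx (Y x)).
  by move=> /im /im_mx_rank.
have jt : left_jump Y t = (\rank (usubmx (Y x)))%:Z - (\rank (usubmx (Y t)))%:Z.
  rewrite /left_jump (rank_left_const xt (r := \rank (usubmx (Y x)))) // => u
    /andP[xu ut].
  by apply: rk; rewrite (ltW xu).
split; [by rewrite ax|exact: jt|by rewrite jt subr_ge0 lez_nat| |].
- move=> y /andP[xy yt]; rewrite /left_jump (rank_left_const xy (r := \rank (usubmx
  (Y x)))).
    by rewrite rk ?(ltW xy) // subrr.
  by move=> u /andP[xu uy]; apply: rk; rewrite (ltW xu) (lt_trans uy).
- move=> y /andP[xy yt]; rewrite /right_jump (rank_right_const yt (r := \rank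
  (usubmx (Y x)))).
    by rewrite rk ?xy // subrr.
  by move=> u /andP[yu ut]; apply: rk; rewrite (le_trans xy (ltW yu)).
Qed.

Lemma jumps_near_right Y a b t : lagrangian_path Y a b -> piecewise_C1 Y a b ->
  monotone_path Y a b -> a <= t < b ->
  \forall x \near t^'+, [/\ t < x < b,
    right_jump Y t = (\rank (usubmx (Y x)))%:Z - (\rank (usubmx (Y t)))%:Z,
    0 <= right_jump Y t,
    forall y, t < y < x -> right_jump Y y = 0 &
    forall y, t < y <= x -> left_jump Y y = 0].
Proof.
move=> lY dY mY atb; apply: filterS (image_near_right lY dY mY atb).
move=> x [xb tx rx im].
have rk y : t < y <= x -> \rank (usubmx (Y y)) = \rank (usubmx (Y x)).
  by move=> /im /im_mx_rank.
have jt : right_jump Y t = (\rank (usubmx (Y x)))%:Z - (\rank (usubmx (Y t)))%:Z.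
  rewrite /right_jump (rank_right_const tx (r := \rank (usubmx (Y x)))) // => u
    /andP[tu ux].
  by apply: rk; rewrite tu ltW.
split; [by rewrite tx|exact: jt|by rewrite jt subr_ge0 lez_nat| |].
- move=> y /andP[ty yx]; rewrite /right_jump (rank_right_const yx (r := \rank
  (usubmx (Y x)))).
    by rewrite rk ?ty ?ltW // subrr.
  by move=> u /andP[yu ux]; apply: rk; rewrite (lt_trans ty yu) ltW.
- move=> y /andP[ty yx]; rewrite /left_jump (rank_left_const ty (r := \rank (usubmx
  (Y x)))).
    by rewrite rk ?ty // subrr.
  by move=> u /andP[tu uy]; apply: rk; rewrite tu (le_trans (ltW uy)).
Qed.

(** On a short interval at most the point [t] contributes. The half-open index sets make the
    property pass to concatenated intervals. *)
Lemma finite_jumps Y a b : a <= b -> lagrangian_path Y a b -> piecewise_C1 Y a b ->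
  monotone_path Y a b ->
  finite_set [set t | (a < t <= b) /\ left_jump Y t != 0] /\
  finite_set [set t | (a <= t < b) /\ right_jump Y t != 0].
Proof.
move=> ab lY dY mY.
pose P x y := finite_set [set t | (x < t <= y) /\ left_jump Y t != 0] /\
  finite_set [set t | (x <= t < y) /\ right_jump Y t != 0].
apply: (interval_induction (P := P)) => //.
- move=> x _; split; rewrite (_ : [set _ | _] = set0) //.
    by apply/seteqP; split=> // t /= [] /andP[xt tx]; move: (lt_le_trans xt tx);
      rewrite ltxx.
  by apply/seteqP; split=> // t /= [] /andP[xt tx]; move: (le_lt_trans xt tx);
    rewrite ltxx.
- move=> x y z _ xy yz _ [f1 g1] [f2 g2]; split.
    have /sub_finite_set : [set t | (x < t <= z) /\ left_jump Y t != 0] `<=`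
        [set t | (x < t <= y) /\ left_jump Y t != 0] `|`
        [set t | (y < t <= z) /\ left_jump Y t != 0].
      move=> t /= [/andP[xt tz] j]; case: (leP t y) => ty; [left|right];
        by rewrite ?xt ?tz.
    by apply; rewrite finite_setU.
  have /sub_finite_set : [set t | (x <= t < z) /\ right_jump Y t != 0] `<=`
      [set t | (x <= t < y) /\ right_jump Y t != 0] `|`
      [set t | (y <= t < z) /\ right_jump Y t != 0].
    move=> t /= [/andP[xt tz] j]; case: (ltP t y) => ty; [left|right];
      by rewrite ?xt ?tz.
  by apply; rewrite finite_setU.
- move=> t atb; apply: filterS (jumps_near_left lY dY mY atb).
  move=> x [_ _ _ jl jr]; split; apply: (sub_finite_set (B := [set t])) => //.
    move=> u /= [/andP[xu ut] ju]; move: ut; rewrite le_eqVlt => /orP[/eqP //|ut].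
    by rewrite jl ?eqxx ?xu in ju.
  by move=> u /= [xut]; rewrite jr // eqxx.
move=> t atb; apply: filterS (jumps_near_right lY dY mY atb).
move=> x [_ _ _ jr jl]; split; apply: (sub_finite_set (B := [set t])) => //.
  by move=> u /= [xut]; rewrite jl // eqxx.
move=> u /= [/andP[tu ux] ju]; move: tu; rewrite le_eqVlt => /orP[/eqP //|tu].
by rewrite jr ?eqxx ?tu in ju.
Qed.

Lemma fsum_single (f : R -> int) (A : set R) t : A t ->
  (forall u, A u -> u != t -> f u = 0) -> \sum_(u \in A) f u = f t.
Proof.
move=> At f0; rewrite (fsbigE [:: t]) //=.
- by rewrite big_cons big_nil mem_set // addr0.
- by move=> u /=; rewrite inE => /eqP ->.
by move=> u Au; rewrite inE; exact: f0.
Qed.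

End Jumps.

(** * Oscillation sums as sums of jumps *)

Section OscillationNumbers.
Variables (R : realType) (n : nat).
Implicit Types (Y Z : R -> 'M[R]_(n + n, n)) (a b c d t : R).

Lemma finite_left_jumps_in Y a b x y : a <= b -> lagrangian_path Y a b ->
  piecewise_C1 Y a b -> monotone_path Y a b -> a <= x -> y <= b ->
  finite_set ([set t | x < t <= y] `&` [set t | left_jump Y t != 0]).
Proof.
move=> ab lY dY mY ax yb; have [f _] := finite_jumps ab lY dY mY.
apply: sub_finite_set f => t /= [/andP[xt ty] j]; split=> //.
by rewrite (le_lt_trans ax) //= (le_trans ty).
Qed.

Lemma finite_right_jumps_in Y a b x y : a <= b -> lagrangian_path Y a b ->
  piecewise_C1 Y a b -> monotone_path Y a b -> a <= x -> y <= b ->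
  finite_set ([set t | x <= t < y] `&` [set t | right_jump Y t != 0]).
Proof.
move=> ab lY dY mY ax yb; have [_ f] := finite_jumps ab lY dY mY.
apply: sub_finite_set f => t /= [/andP[xt ty] j]; split=> //.
by rewrite (le_trans ax) //= (lt_le_trans ty).
Qed.

Lemma left_jumps_cat Y a b x y z : a <= b -> lagrangian_path Y a b ->
  piecewise_C1 Y a b -> monotone_path Y a b ->
  a <= x -> x <= y -> y <= z -> z <= b ->
  \sum_(t \in [set t | x < t <= z]) left_jump Y t =
    \sum_(t \in [set t | x < t <= y]) left_jump Y t +
    \sum_(t \in [set t | y < t <= z]) left_jump Y t.
Proof.
move=> ab lY dY mY ax xy yz zb; rewrite -fsum_disjoint.
- apply: eq_fsbigl; apply/seteqP; split=> t /=.
    by move=> /andP[xt tz]; case: (leP t y) => ty; [left|right]; rewrite ?xt ?tz.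
  move=> [/andP[xt ty]|/andP[yt tz]]; first by rewrite xt (le_trans ty).
  by rewrite tz (le_lt_trans xy).
- exact: (finite_left_jumps_in ab lY dY mY ax (le_trans yz zb)).
- exact: (finite_left_jumps_in ab lY dY mY (le_trans ax xy) zb).
by move=> t /= [/andP[_ ty] /andP[yt _]]; rewrite leNgt yt in ty.
Qed.

Lemma right_jumps_cat Y a b x y z : a <= b -> lagrangian_path Y a b ->
  piecewise_C1 Y a b -> monotone_path Y a b ->
  a <= x -> x <= y -> y <= z -> z <= b ->
  \sum_(t \in [set t | x <= t < z]) right_jump Y t =
    \sum_(t \in [set t | x <= t < y]) right_jump Y t +
    \sum_(t \in [set t | y <= t < z]) right_jump Y t.
Proof.
move=> ab lY dY mY ax xy yz zb; rewrite -fsum_disjoint.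
- apply: eq_fsbigl; apply/seteqP; split=> t /=.
    by move=> /andP[xt tz]; case: (ltP t y) => ty; [left|right]; rewrite ?xt ?tz.
  move=> [/andP[xt ty]|/andP[yt tz]]; first by rewrite xt (lt_le_trans ty).
  by rewrite tz (le_trans xy).
- exact: (finite_right_jumps_in ab lY dY mY ax (le_trans yz zb)).
- exact: (finite_right_jumps_in ab lY dY mY (le_trans ax xy) zb).
by move=> t /= [/andP[_ ty] /andP[yt _]]; rewrite ltNge yt in ty.
Qed.

(** Both identities are additive in the endpoints, so interval induction reduces them to the
    one-sided comparisons: the index changes only on arrival at a point, the dual index only on
    departure. *)
Lemma cind_jumps Y Z a b c d : a <= b -> lagrangian_path Y a b ->
  piecewise_C1 Y a b -> monotone_path Y a b -> a <= c -> c <= d -> d <= b ->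
  (forall t, c < t <= d -> mx_cvg t^'- Z (Z t)) ->
  (forall t, c <= t < d -> mx_cvg t^'+ Z (Z t)) ->
  (forall t, c <= t <= d -> lagrangian (Z t)) ->
  (forall t u, c <= t <= d -> c <= u <= d ->
     \rank (wronskian (Z t) (Y t)) = \rank (wronskian (Z u) (Y u)) /\
     \rank (usubmx (Z t)) = \rank (usubmx (Z u))) ->
  (cind (Y d) (Z d))%:Z - (cind (Y c) (Z c))%:Z =
    \sum_(t \in [set t | c < t <= d]) left_jump Y t /\
  (dual_cind (Y c) (Z c))%:Z - (dual_cind (Y d) (Z d))%:Z =
    \sum_(t \in [set t | c <= t < d]) right_jump Y t.
Proof.
move=> ab lY dY mY ac cd db Zl Zr lZ rkZ.
pose P x y :=
  (cind (Y y) (Z y))%:Z - (cind (Y x) (Z x))%:Z =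
    \sum_(t \in [set t | x < t <= y]) left_jump Y t /\
  (dual_cind (Y x) (Z x))%:Z - (dual_cind (Y y) (Z y))%:Z =
    \sum_(t \in [set t | x <= t < y]) right_jump Y t.
have add (u v w s1 s2 : int) : v - u = s1 -> w - v = s2 -> w - u = s1 + s2.
  by move=> <- <-; rewrite [RHS]addrC addrA subrK.
apply: (interval_induction (P := P) cd).
- move=> x _; split; rewrite subrr fsbig1 // => t /= /andP[xt tx].
    by move: (lt_le_trans xt tx); rewrite ltxx.
  by move: (le_lt_trans xt tx); rewrite ltxx.
- move=> x y z cx xy yz zd [p1 q1] [p2 q2]; split.
    rewrite (left_jumps_cat ab lY dY mY (le_trans ac cx) xy yz (le_trans zd db)).
    exact: add p1 p2.
  rewrite (right_jumps_cat ab lY dY mY (le_trans ac cx) xy yz (le_trans zd db)).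
  by rewrite [RHS]addrC; exact: add q2 q1.
- move=> t ctd; have /andP[ct td] := ctd.
  have atb : a < t <= b by rewrite (le_lt_trans ac) //= (le_trans td).
  have nearZ : \forall x \near t^'-, [/\ lagrangian (Z x),
      \rank (wronskian (Z x) (Y x)) = \rank (wronskian (Z t) (Y t)) &
      \rank (usubmx (Z x)) = \rank (usubmx (Z t))].
    apply: (itv_near_left ct) => x /andP[cx xt].
    have cxd : c <= x <= d by rewrite (ltW cx) (le_trans (ltW xt)).
    have ctd' : c <= t <= d by rewrite (ltW ct).
    have [r1 r2] := rkZ _ _ cxd ctd'.
    by split; [exact: lZ|exact: r1|exact: r2].
  have lZt : lagrangian (Z t) by apply: lZ; rewrite (ltW ct).
  apply: filterS2 (cind_near_left lY dY mY atb (Zl _ ctd) lZt nearZ)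
    (jumps_near_left lY dY mY atb).
  move=> x [c1 c2] [/andP[_ xt] jt _ jl jr]; split.
    rewrite (fsum_single (t := t)) /=; last 2 first.
    + by rewrite xt lexx.
    + move=> u /andP[xu ut] nut; apply: jl; by rewrite xu lt_neqAle nut.
    rewrite jt; move: c1; move: (cind _ _) (cind _ _) (\rank _) (\rank _).
    by move=> *; lia.
  rewrite fsbig1; first by rewrite c2 subrr.
  exact: jr.
move=> t ctd; have /andP[ct td] := ctd.
have atb : a <= t < b by rewrite (le_trans ac) //= (lt_le_trans td).
have nearZ : \forall x \near t^'+, [/\ lagrangian (Z x),
    \rank (wronskian (Z x) (Y x)) = \rank (wronskian (Z t) (Y t)) &
    \rank (usubmx (Z x)) = \rank (usubmx (Z t))].
  apply: (itv_near_right td) => x /andP[tx xd].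
  have cxd : c <= x <= d by rewrite (ltW xd) (le_trans ct (ltW tx)).
  have ctd' : c <= t <= d by rewrite ct ltW.
  have [r1 r2] := rkZ _ _ cxd ctd'.
  by split; [exact: lZ|exact: r1|exact: r2].
have lZt : lagrangian (Z t) by apply: lZ; rewrite ct ltW.
apply: filterS2 (cind_near_right lY dY mY atb (Zr _ ctd) lZt nearZ)
  (jumps_near_right lY dY mY atb).
move=> x [c1 c2] [/andP[tx _] jt _ jr jl]; split.
  rewrite fsbig1; first by rewrite c1 subrr.
  exact: jl.
rewrite (fsum_single (t := t)) /=; last 2 first.
+ by rewrite tx lexx.
+ move=> u /andP[tu ux] nut; apply: jr; by rewrite ux lt_neqAle eq_sym nut tu.
rewrite jt; move: c2; move: (dual_cind _ _) (dual_cind _ _) (\rank _) (\rank _).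
by move=> *; lia.
Qed.

(** The value is the same for every admissible system, so independence of the choice is obtained
    along the way. *)
Lemma osc_sum_jumps Y a b s (S : nat -> R -> 'M[R]_(n + n)) : a <= b ->
  lagrangian_path Y a b -> piecewise_C1 Y a b -> monotone_path Y a b ->
  osc_system Y a b s S ->
  osc_sum Y a b s S = \sum_(t \in [set t | a < t <= b]) left_jump Y t /\
  dual_osc_sum Y a b s S = \sum_(t \in [set t | a <= t < b]) right_jump Y t.
Proof.
move=> ab lY dY mY [ps sysS].
pose u k := knot a b s k.
have u_ge k : (k <= size s)%N -> a <= u k by exact: knot_ge ps.
have u_le k : (k <= size s)%N -> u k <= b by exact: knot_le ps.
have u_lt k : (k < size s)%N -> u k < u k.+1 by exact: knot_lt ps.
have piece k : (k < size s)%N ->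
    (cind (Y (u k.+1)) (S k (u k.+1) *m Emx R n))%:Z -
      (cind (Y (u k)) (S k (u k) *m Emx R n))%:Z =
      \sum_(t \in [set t | u k < t <= u k.+1]) left_jump Y t /\
    (dual_cind (Y (u k)) (S k (u k) *m Emx R n))%:Z -
      (dual_cind (Y (u k.+1)) (S k (u k.+1) *m Emx R n))%:Z =
      \sum_(t \in [set t | u k <= t < u k.+1]) right_jump Y t.
  move=> ks; have [symp cS rW rX] := sysS k ks.
  have itv t : (t \in `[knot a b s k, knot a b s k.+1]) = (u k <= t <= u k.+1).
    by rewrite in_itv.
  apply: (cind_jumps (Z := fun t => S k t *m Emx R n) ab lY dY mY
    (u_ge k (ltnW ks)) (ltW (u_lt k ks)) (u_le k.+1 ks)).
  - move=> t kt; have cSt := within_cvg_left cS kt.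
    by apply: mx_cvgM => //; exact: mx_cvg_cst.
  - move=> t kt; have cSt := within_cvg_right cS kt.
    by apply: mx_cvgM => //; exact: mx_cvg_cst.
  - by move=> t kt; apply: symplectic_lagrangian; apply: symp; rewrite itv.
  move=> t w kt kw; split; first by apply: rW; rewrite itv.
  by rewrite -!upper_block; apply: rX; rewrite itv.
have ends : u 0%N = a /\ u (size s) = b by split; [|exact: knot_size].
have sums m : (m <= size s)%N ->
    \sum_(k < m) ((cind (Y (u k.+1)) (S k (u k.+1) *m Emx R n))%:Z -
      (cind (Y (u k)) (S k (u k) *m Emx R n))%:Z) =
      \sum_(t \in [set t | a < t <= u m]) left_jump Y t /\
    \sum_(k < m) ((dual_cind (Y (u k)) (S k (u k) *m Emx R n))%:Z -
      (dual_cind (Y (u k.+1)) (S k (u k.+1) *m Emx R n))%:Z) =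
      \sum_(t \in [set t | a <= t < u m]) right_jump Y t.
  elim: m => [_|m IH ms].
    rewrite ends.1 !big_ord0; split; rewrite fsbig1 // => t /= /andP[h1 h2].
      by move: (lt_le_trans h1 h2); rewrite ltxx.
    by move: (le_lt_trans h1 h2); rewrite ltxx.
  have [IH1 IH2] := IH (ltnW ms); have [p1 p2] := piece m ms.
  rewrite !big_ord_recr /= IH1 IH2 p1 p2; split; apply: esym.
    exact: (left_jumps_cat ab lY dY mY (lexx a) (u_ge m (ltnW ms))
      (ltW (u_lt m ms)) (u_le m.+1 ms)).
  exact: (right_jumps_cat ab lY dY mY (lexx a) (u_ge m (ltnW ms))
    (ltW (u_lt m ms)) (u_le m.+1 ms)).
by have := sums (size s) (leqnn _); rewrite ends.2.
Qed.

(** A constant shear is used on each piece: its Wronskian with [Y] is the invertible chart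
    denominator, of rank n up to and including the knots. *)
Lemma osc_system_exists Y a b : a <= b -> lagrangian_path Y a b ->
  exists s S, osc_system Y a b s S.
Proof.
move=> ab lY.
pose G x y := exists q, forall w, x <= w <= y -> chart_den q (Y w) \in unitmx.
have chart_at t : a <= t <= b -> exists q, chart_den q (Y t) \in unitmx.
  move=> atb; have lYt := lagrangian_path_in lY atb.
  by have [q [uYt _]] := common_chart lYt lYt; exists q.
have [||s ps sG] := @local_partition R G a b ab.
- move=> t atb; have [at_ tb] := andP atb.
  have [|q uYt] := chart_at t; first by rewrite ltW.
  have [p pt pP] := near_left_itv
    (mx_cvg_unitmx (mx_cvg_chart_den (within_cvg_left lY.1 atb)) uYt).
  apply: (itv_near_left pt) => x /andP[px xt]; exists q => w /andP[xw].
  rewrite le_eqVlt => /orP[/eqP -> //|wt].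
  by apply: pP; rewrite wt (lt_le_trans px).
- move=> t atb; have [at_ tb] := andP atb.
  have [|q uYt] := chart_at t; first by rewrite at_ ltW.
  have [r tr rP] := near_right_itv
    (mx_cvg_unitmx (mx_cvg_chart_den (within_cvg_right lY.1 atb)) uYt).
  apply: (itv_near_right tr) => x /andP[tx xr]; exists q => w /andP[].
  rewrite le_eqVlt => /orP[/eqP <- //|tw] wx.
  by apply: rP; rewrite tw (le_lt_trans wx).
have /choice [q qP] : forall k, exists q, (k < size s)%N ->
    forall w, knot a b s k <= w <= knot a b s k.+1 -> chart_den q (Y w) \in unitmx.
  (* Indices beyond the partition receive the irrelevant parameter 0. *)
  move=> k; case: (boolP (k < size s)%N) => [ks|_]; last by exists 0.
  by have [q qP] := sG k ks; exists q.
exists s, (fun k _ => shear n (q k)); split=> // k ks; split.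
- by move=> t _; exact: shear_symplectic.
- by move=> t; exact: cvg_cst.
- move=> t w; rewrite !in_itv /= => kt kw.
  by rewrite !wronskian_shear !mxrank_unit //; exact: qP.
by [].
Qed.

End OscillationNumbers.

Theorem theorem4p6 (R : realType) (n : nat) (a b : R) (hab : a <= b)
    (Y : R -> 'M[R]_(n + n, n))
    (Ylagr : lagrangian_path Y a b)
    (YC1 : piecewise_C1 Y a b)
    (Ymono : monotone_path Y a b) :
  [/\ piecewise_constant_on (fun t => im_mx (usubmx (Y t))) a b,
      [/\ finite_set [set t | (a < t <= b) /\
            (rank_left Y t)%:Z - (\rank (usubmx (Y t)))%:Z != 0],
          osc_number Y a b =
            \sum_(t \in [set t | a < t <= b])
              ((rank_left Y t)%:Z - (\rank (usubmx (Y t)))%:Z) &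
          0 <= osc_number Y a b] &
      [/\ finite_set [set t | (a <= t < b) /\
            (rank_right Y t)%:Z - (\rank (usubmx (Y t)))%:Z != 0],
          dual_osc_number Y a b =
            \sum_(t \in [set t | a <= t < b])
              ((rank_right Y t)%:Z - (\rank (usubmx (Y t)))%:Z) &
          0 <= dual_osc_number Y a b]].
Proof.
have [finl finr] := finite_jumps hab Ylagr YC1 Ymono.
have [s [S sysS]] := osc_system_exists hab Ylagr.
have [sumS dualS] := osc_sum_jumps hab Ylagr YC1 Ymono sysS.
have N : osc_number Y a b = \sum_(t \in [set t | a < t <= b]) left_jump Y t.
  (* Whichever system [xget] selects has this jump sum; the system [S] rules out the default
     value. *)
  rewrite /osc_number; case: xgetP => [_ _ [s' [S' [sys' ->]]]|none].
    by have [-> _] := osc_sum_jumps hab Ylagr YC1 Ymono sys'.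
  by have [] := none (osc_sum Y a b s S); exists s, S.
have Nd : dual_osc_number Y a b =
    \sum_(t \in [set t | a <= t < b]) right_jump Y t.
  rewrite /dual_osc_number; case: xgetP => [_ _ [s' [S' [sys' ->]]]|none].
    by have [_ ->] := osc_sum_jumps hab Ylagr YC1 Ymono sys'.
  by have [] := none (dual_osc_sum Y a b s S); exists s, S.
split.
(* Only interior points of each piece are compared, since the image may differ at the knots. *)
- have [||s' ps' imS] := @local_partition R (fun x y => forall u v,
      x < u < y -> x < v < y -> im_mx (usubmx (Y u)) = im_mx (usubmx (Y v))) a b hab.
  + move=> t atb; apply: filterS (image_near_left Ylagr YC1 Ymono atb).
    move=> x [_ _ _ im] u v /andP[xu ut] /andP[xv vt].
    by rewrite !im // ?(ltW xu) ?(ltW xv).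
  + move=> t atb; apply: filterS (image_near_right Ylagr YC1 Ymono atb).
    move=> x [_ _ _ im] u v /andP[tu ux] /andP[tv vx].
    by rewrite !im // ?tu ?tv ltW.
  exists s' => // k ks u v; rewrite !in_itv /= => ku kv; exact: imS ku kv.
- split; [exact: finl|exact: N|rewrite N].
  apply: fsumr_ge0 => t /= atb.
  (* Any point close to [t] yields the sign of the jump; the midpoint is such a point. *)
  have [p pt pP] := near_left_itv (jumps_near_left Ylagr YC1 Ymono atb).
  by have [|] := pP ((p + t) / 2); first by rewrite !midf_lt.
split; [exact: finr|exact: Nd|rewrite Nd].
apply: fsumr_ge0 => t /= atb.
have [r tr rP] := near_right_itv (jumps_near_right Ylagr YC1 Ymono atb).
by have [|] := rP ((t + r) / 2); first by rewrite !midf_lt.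
Qed.
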